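(* Let $E$ be a separable (real) Banach space and $\mu$ a centered Gaussian probability on $E$. For $\varepsilon>0$ let $\mu_\varepsilon$ be the image of $\mu$ under the map $x\mapsto\varepsilon x$. Then the family $(\mu_\varepsilon)_\varepsilon$ is exponentially tight at speed $\varepsilon\mapsto\varepsilon^2$, i.e. for every $R>0$ there exists a compact set $K_R\subset E$ such that $$\limsup_{\varepsilon\to0}\varepsilon^2\log\mu_\varepsilon(K_R^c)\le -R .$$
   Context: $K_R^c$ denotes the complement of $K_R$ in $E$, with the convention $\log 0=-\infty$. *)

(* Defs.v *)
From HB Require Import structures.
From mathcomp Require Import all_boot all_order all_algebra.
From mathcomp Require Import all_classical all_reals all_analysis.

Set Implicit Arguments.
Unset Strict Implicit.
Unset Printing Implicit Defensive.

Import Order.TTheory GRing.Theory Num.Theory.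
Import numFieldNormedType.Exports.

Local Open Scope classical_set_scope.
Local Open Scope ring_scope.

Definition separable (T : topologicalType) :=
  exists2 D : set T, countable D & dense D.

(* E with its Borel sigma-algebra; convertible to E, so that subsets, functions
   and the topology of E can be used on it directly. *)
Definition borel (R : realType) (E : completeNormedModType R) :=
  g_sigma_algebraType (@open E).

(* The law N(m, s^2) on the line. The case s = 0 has to be treated apart because
   normal_prob m 0 is the uniform law on [0, 1] rather than the point mass. *)
Definition normal_law (R : realType) (m s : R) :
    set (measurableTypeR R) -> \bar R :=
  if s == 0 then \d_ m else normal_prob m s.

(* Every continuous linear functional has a centered, possibly degenerate,
   normal law under mu. *)
Definition centered_gaussian (R : realType) (E : completeNormedModType R)
    (mu : probability (borel E) R) :=
  forall f : {linear E -> R^o}, continuous f ->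
  exists2 s : R, 0 <= s &
    forall A : set (measurableTypeR R), measurable A ->
      pushforward mu (f : borel E -> measurableTypeR R) A = normal_law 0 s A.

Definition scaled (R : realType) (E : completeNormedModType R)
    (mu : probability (borel E) R) (e : R) : set (borel E) -> \bar R :=
  pushforward mu ((fun x : E => e *: x) : borel E -> borel E).

(* nu e is only relevant for e > 0, the limit superior being taken along 0^'+;
   lne is the extended logarithm, with lne 0 = -oo. *)
Definition exponentially_tight (R : realType) (E : completeNormedModType R)
    (nu : R -> set (borel E) -> \bar R) (speed : R -> R) :=
  forall r : R, 0 < r ->
  exists2 K : set E, compact K &
    (limf_esup (fun e : R => (speed e)%:E * lne (nu e (~` K))) 0^'+
       <= (- r)%:E)%E.

(* Main.v *)
(** Tightness of mu gives an absolutely convex, totally bounded Borel set K with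
    mu K >= 4/5. Since (X + Y)/sqrt 2 and (X - Y)/sqrt 2 are again independent
    with law mu when X and Y are, Fernique's argument applied to K in place of a
    ball yields, for a t := mu (~ (t K)),
      mu K * a (1 + sqrt 2 u) <= a u ^ 2,   hence   a t <= exp (- t^2 / 32)   (t >= 4),
    and K_r := l * closure K with l^2 = 32 r is the required compact set, because
    mu_e (~ K_r) <= a (l / e).

    Only the laws of continuous functionals are known, so the rotation invariance
    of mu x mu rests on three facts: by Hahn-Banach and separability the Borel sets
    are generated by the dual; a probability is determined on that sigma-algebra by
    the integrals of cos (phi) and sin (phi) for phi in the dual; and the law of
    g X + h Y is normal with variance the sum of the variances, the variance being
    a quadratic form in the functional. *)

Require Import Defs.
From HB Require Import structures.
From mathcomp Require Import all_boot all_order all_algebra.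
From mathcomp Require Import all_classical all_reals all_analysis measurable_realfun.
From mathcomp Require Import ring lra.

Set Implicit Arguments.
Unset Strict Implicit.
Unset Printing Implicit Defensive.

Import Order.TTheory GRing.Theory Num.Theory.
Import numFieldNormedType.Exports.

Local Open Scope classical_set_scope.
Local Open Scope ring_scope.

(** * Hahn-Banach *)

(** Homogeneity is asked only as an inequality for positive scalars, the form that passes to infima;
    [sublinearZ] recovers equality. *)
Definition sublinear (R : realType) (V : lmodType R) (p : V -> R) :=
  (forall x y, p (x + y) <= p x + p y) /\
  (forall t x, 0 < t -> p (t *: x) <= t * p x).

Section hahn_banach.
Context {R : realType} {V : lmodType R}.
Implicit Types (p q : V -> R) (x y : V).

Lemma sublinearZ p t x : sublinear p -> 0 < t -> p (t *: x) = t * p x.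
Proof.
move=> [_ pZ] t0; apply/eqP; rewrite eq_le pZ//=.
have := pZ t^-1 (t *: x); rewrite invr_gt0 => /(_ t0).
by rewrite scalerA mulVf ?gt_eqF// scale1r mulrC ler_pdivlMr// mulrC.
Qed.

Lemma sublinear0 p : sublinear p -> p 0 = 0.
Proof.
move=> sp; have := @sublinearZ p 2 0 sp; rewrite ltr0n scaler0 => /(_ isT); lra.
Qed.

Lemma sublinearN p x : sublinear p -> - p (- x) <= p x.
Proof.
move=> sp; have := sp.1 x (- x); rewrite subrr sublinear0//; lra.
Qed.

(** For sublinear [p], the largest sublinear functional below [p] whose value at [- y] is at most
    [- p y]. *)
Definition ray_inf p y x := inf [set p (x + t *: y) - t * p y | t in [set t | 0 <= t]].

Lemma ray_inf_le p y x t : sublinear p -> 0 <= t ->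
  ray_inf p y x <= p (x + t *: y) - t * p y.
Proof.
move=> sp t0; apply: ge_inf; last by exists t.
(* Subadditivity applied to [s *: y = (x + s *: y) + (- x)] bounds the set below. *)
exists (- p (- x)) => _ [s /= s0 <-].
have [->|sn0] := eqVneq s 0.
  by rewrite scale0r mul0r addr0 subr0 sublinearN.
rewrite -sublinearZ ?lt0r ?sn0//.
have := sp.1 (x + s *: y) (- x); rewrite addrC addKr; lra.
Qed.

Lemma ray_inf_ge p y x c :
  (forall t, 0 <= t -> c <= p (x + t *: y) - t * p y) -> c <= ray_inf p y x.
Proof.
move=> h; apply: lb_le_inf.
  by exists (p (x + 0 *: y) - 0 * p y); exists 0 => /=.
by move=> _ [t /= t0 <-]; exact: h.
Qed.

Lemma ray_inf_lep p y x : sublinear p -> ray_inf p y x <= p x.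
Proof.
move=> sp; have := @ray_inf_le p y x 0 sp (lexx _).
by rewrite scale0r mul0r addr0 subr0.
Qed.

Lemma ray_infN p y : sublinear p -> ray_inf p y (- y) <= - p y.
Proof.
move=> sp; have := @ray_inf_le p y (- y) 1 sp ler01.
by rewrite scale1r mul1r addNr sublinear0// sub0r.
Qed.

(** Adding the parameters [t] and [t'] gives subadditivity; rescaling [t] to [s * t] gives
    homogeneity. *)
Lemma ray_inf_sublinear p y : sublinear p -> sublinear (ray_inf p y).
Proof.
move=> sp; split=> [x x'|s x s0].
  rewrite -lerBlDr; apply: ray_inf_ge => t t0.
  rewrite lerBlDr -lerBlDl; apply: ray_inf_ge => t' t'0.
  rewrite lerBlDl (le_trans (@ray_inf_le p y _ (t + t') sp _)) ?addr_ge0//.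
  have := sp.1 (x + t *: y) (x' + t' *: y).
  by rewrite addrACA -scalerDl; lra.
rewrite -ler_pdivrMl//; apply: ray_inf_ge => t t0.
rewrite ler_pdivrMl//; apply: le_trans (@ray_inf_le p y _ (s * t) sp _) _.
  by rewrite mulr_ge0// ltW.
by rewrite -scalerA -scalerDr sublinearZ// mulrBr mulrA.
Qed.

(* The functional is a minimal element of the sublinear functionals below p:
   minimality forces ray_inf q y = q, hence q (x + y) >= q x + q y. *)
Theorem hahn_banach p : sublinear p ->
  exists f : {linear V -> R^o}, forall x, f x <= p x.
Proof.
move=> sp.
pose T := {q : V -> R | sublinear q /\ forall x, q x <= p x}.
(* The order is reversed, so that Zorn's maximal element is pointwise minimal. *)
pose le (a b : T) : bool := `[< forall x, sval b x <= sval a x >].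
have [q qmin] : exists t, forall s, le t s -> s = t.
  apply: Zorn.
  - by move=> t; apply/asboolP.
  - move=> r s t /asboolP rs /asboolP st; apply/asboolP => x.
    exact: le_trans (st x) (rs x).
  - move=> [s ps] [t pt] /asboolP st /asboolP ts.
    suff E : s = t by subst t; congr exist; exact: Prop_irrelevance.
    by apply/funext => x; apply/le_anti; rewrite st ts.
  - move=> A Atot; have [->|/set0P[a0 Aa0]] := eqVneq A set0.
      by exists (exist _ p (conj sp (fun=> lexx _))) => s [].
    (* A nonempty chain is bounded by its pointwise infimum, which is finite because every member is
       at least [- p (- x)] at [x]. *)
    pose q x := inf [set sval a x | a in A].
    have q_le a x : A a -> q x <= sval a x.
      move=> Aa; apply: ge_inf; last by exists a.
      exists (- p (- x)) => _ [b Ab <-].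
      have [sb bp] := svalP b.
      by rewrite (le_trans _ (sublinearN _ sb))// lerN2.
    have q_ge x c : (forall a, A a -> c <= sval a x) -> c <= q x.
      move=> h; apply: lb_le_inf; first by exists (sval a0 x), a0.
      by move=> _ [a Aa <-]; exact: h.
    have sq : sublinear q.
      split=> [x y|t x t0].
        rewrite -lerBlDr; apply: (q_ge) => a Aa.
        rewrite lerBlDr -lerBlDl; apply: (q_ge) => b Ab; rewrite lerBlDl.
        (* One of [a] and [b] lies below the other, and its own subadditivity gives the bound. *)
        have [/asboolP ab|/asboolP ba] := Atot _ _ Aa Ab.
          rewrite (le_trans (q_le _ _ Ab))//.
          by rewrite (le_trans ((svalP b).1.1 x y))// lerD2r.
        rewrite (le_trans (q_le _ _ Aa))//.
        by rewrite (le_trans ((svalP a).1.1 x y))// lerD2l.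
      rewrite -ler_pdivrMl//; apply: (q_ge) => a Aa.
      rewrite ler_pdivrMl// (le_trans (q_le _ _ Aa))//.
      exact: (svalP a).1.2.
    have qp x : q x <= p x.
      exact: le_trans (q_le _ _ Aa0) ((svalP a0).2 x).
    by exists (exist _ q (conj sq qp)) => a Aa; apply/asboolP => x; exact: q_le.
case: q qmin => q [sq qp] /= qmin.
have qray y : ray_inf q y = q.
  have sr : sublinear (ray_inf q y) /\ forall x, ray_inf q y x <= p x.
    split; first exact: ray_inf_sublinear.
    by move=> x; rewrite (le_trans (ray_inf_lep _ _ sq)).
  have : exist _ _ sr = exist _ _ (conj sq qp) :> T.
    by apply: qmin; apply/asboolP => x /=; exact: ray_inf_lep.
  by case.
have qD x y : q (x + y) = q x + q y.
  apply/eqP; rewrite eq_le sq.1/=.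
  have := @ray_inf_le q y x 1 sq ler01; rewrite qray scale1r mul1r; lra.
have qN x : q (- x) = - q x.
  by have := qD x (- x); rewrite subrr sublinear0//; lra.
have qlin : linear (q : V -> R^o).
  move=> t x y; rewrite qD; congr +%R.
  have [t0|t0|->] := ltgtP t 0; last by rewrite scale0r sublinear0// scale0r.
    by rewrite -[t]opprK scaleNr qN sublinearZ ?oppr_gt0// scaleNr.
  exact: sublinearZ.
pose L := GRing.isLinear.Build R V R^o *:%R (q : V -> R^o) qlin.
pose f : {linear V -> R^o} := HB.pack (q : V -> R^o) L.
by exists f.
Qed.

End hahn_banach.

(** Hahn-Banach is applied to [ray_inf] of the norm in the direction [x0]: it lies below the norm
    and forces [f (- x0) <= - |x0|]. *)
Lemma norming_functional (R : realType) (E : normedModType R) (x0 : E) :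
  exists f : {linear E -> R^o},
    [/\ continuous f, forall x, `|f x| <= `|x| & f x0 = `|x0|].
Proof.
pose n := fun x : E => `|x|.
have sn : sublinear n.
  split=> [x y|t x t0]; first exact: ler_normD.
  by rewrite /n normrZ gtr0_norm.
have [f fp] := hahn_banach (ray_inf_sublinear x0 sn).
have fn x : f x <= `|x| by rewrite (le_trans (fp x))// ray_inf_lep.
have fb x : `|f x| <= `|x|.
  by rewrite ler_norml fn andbT lerNl -raddfN -normrN fn.
exists f; split => //.
  apply: bounded_linear_continuous; exists 1; split; first exact: num_real.
  move=> M M1; apply: filterS (nbhs0_le ltr01) => x x1 /=.
  by rewrite (le_trans (fb x))// (le_trans x1)// ltW.
apply/le_anti; rewrite fn/= -lerN2 -raddfN.
exact: le_trans (fp _) (ray_infN _ sn).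
Qed.

(** * Uniqueness from trigonometric integrals *)

Lemma bernoulli_ineq (R : realDomainType) (u : R) k :
  -1 <= u -> 1 + k%:R * u <= (1 + u) ^+ k.
Proof.
move=> u1; have [u1'|u1'] := leP 0 (1 + u); last by lra.
elim: k => [|k IH]; first by rewrite mul0r addr0 expr0.
rewrite exprS (le_trans _ (ler_wpM2l u1' IH))//.
rewrite -natr1 -subr_ge0.
rewrite (_ : _ - _ = k%:R * u ^+ 2); last by ring.
by rewrite mulr_ge0 ?sqr_ge0.
Qed.

(** With [z = w ^+ 2] and [h = w^-1 - 1], Bernoulli gives [n * w ^+ n <= h^-1], so the sequence is
    at most [h^-1 * w ^+ n]. *)
Lemma cvg_natr_expr (R : realType) (z : R) : 0 <= z < 1 ->
  n%:R * z ^+ n @[n --> \oo] --> (0 : R).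
Proof.
move=> /andP[z0 z1]; have [->|zn0] := eqVneq z 0.
  apply: cvg_near_cst; near=> n; rewrite expr0n gtn_eqF ?mulr0//.
  by near: n; exact: nbhs_infty_gt.
have {z0 zn0} z0 : 0 < z by rewrite lt0r zn0.
pose w := Num.sqrt z.
have w0 : 0 < w by rewrite sqrtr_gt0.
have ww : z = w * w by rewrite -expr2 sqr_sqrtr// ltW.
have w1 : w < 1 by rewrite -sqrtr1 ltr_sqrt.
pose h := w^-1 - 1.
have h0 : 0 < h by rewrite subr_gt0 invf_gt1.
apply: (@squeeze_cvgr _ _ _ _ (cst 0) (fun n => h^-1 * w ^+ n)).
- near=> n; rewrite /= mulr_ge0 ?exprn_ge0 ?(ltW z0)//=.
  rewrite ww exprMn mulrA ler_wpM2r ?exprn_ge0 ?(ltW w0)//.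
  rewrite -[leRHS]mul1r ler_pdivlMr// -[leRHS](@divff _ (w^-1 ^+ n)); last first.
    by rewrite gt_eqF// exprn_gt0// invr_gt0.
  rewrite exprVn invrK.
  have wn : 0 < w ^+ n by rewrite exprn_gt0.
  rewrite mulrAC ler_pM2r//.
  have := @bernoulli_ineq _ h n.
  rewrite (_ : 1 + h = w^-1) ?exprVn; last by rewrite addrC subrK.
  by move=> /(_ _); lra.
- exact: cvg_cst.
- rewrite -(mulr0 h^-1); apply: cvgMr; apply: cvg_expr.
  by rewrite ger0_norm ?ltW.
Unshelve. all: by end_near. Qed.

(* The factor n in the exponent makes the limit at the threshold x = 1/2 exactly 0. *)
Lemma cvg_step (R : realType) (x : R) : 0 <= x <= 1 ->
  (1 - x ^+ n) ^+ (n * 2 ^ n) @[n --> \oo] --> ((x < 2^-1)%R%:R : R).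
Proof.
move=> /andP[x0 x1].
have xn0 n : 0 <= x ^+ n by rewrite exprn_ge0.
have xn1 n : x ^+ n <= 1 by rewrite exprn_ile1.
have y0 n : 0 <= 1 - x ^+ n by rewrite subr_ge0.
have [xh|xh] := ltP x 2^-1.
  apply: (@squeeze_cvgr _ _ _ _ (fun n => 1 - n%:R * (2 * x) ^+ n) (cst 1)).
  - near=> n; apply/andP; split; last first.
      by rewrite exprn_ile1// lerBlDr lerDl.
    have := @bernoulli_ineq _ (- x ^+ n) (n * 2 ^ n).
    rewrite lerN2 => /(_ (xn1 n)); apply: le_trans.
    by rewrite natrM natrX exprMn mulrN mulrA.
  - rewrite -[X in _ --> X]subr0; apply: cvgB; first exact: cvg_cst.
    by apply: cvg_natr_expr; apply/andP; split; lra.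
  - exact: cvg_cst.
(* For [2 * x >= 1], [(1 - u) ^+ k * (1 + u) ^+ k <= 1] while Bernoulli gives
   [(1 + u) ^+ k >= 1 + k * u >= n + 1]. *)
apply: (@squeeze_cvgr _ _ _ _ (cst 0) (fun n => (n.+1%:R)^-1)).
- near=> n; rewrite exprn_ge0//=.
  set k := (n * 2 ^ n)%N; set u := x ^+ n.
  have u0 : 0 <= u := xn0 n; have u1 : 0 <= 1 - u := y0 n.
  have nku : n.+1%:R <= 1 + k%:R * u.
    rewrite -natr1 addrC lerD2l /k natrM natrX -mulrA ler_peMr//.
    by rewrite /u -exprMn exprn_ege1//; lra.
  rewrite -[leRHS]mul1r ler_pdivlMr//.
  rewrite (@le_trans _ _ ((1 - u) ^+ k * (1 + u) ^+ k))//.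
    rewrite ler_wpM2l ?exprn_ge0// (le_trans nku)// bernoulli_ineq//.
    by rewrite (le_trans _ u0).
  rewrite -exprMn exprn_ile1//.
    by rewrite mulr_ge0// addr_ge0.
  by rewrite -subr_sqr expr1n lerBlDr lerDl sqr_ge0.
- exact: cvg_cst.
- exact: cvg_harmonic.
Unshelve. all: by end_near. Qed.

(** * Bounded limits of trigonometric functions *)

Section trig_class.
Context (T : Type) (R : realType) (Phi : set (T -> R)).

(** Each rule preserves equality of integrals under two probabilities; the uniform bound in
    [trig_lim] serves dominated convergence. *)
Inductive trig_class : (T -> R) -> Prop :=
| trig_cos f : Phi f -> trig_class (fun x => cos (f x))
| trig_sin f : Phi f -> trig_class (fun x => sin (f x))
| trig_lin a b F G : trig_class F -> trig_class G ->
    trig_class (fun x => a * F x + b * G x)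
| trig_lim F_ G M : (forall n, trig_class (F_ n)) ->
    (forall n x, `|F_ n x| <= M) ->
    (forall x, F_ n x @[n --> \oo] --> G x) -> trig_class G.

Hypothesis Phi_lin : forall a b f g, Phi f -> Phi g ->
  Phi (fun x => a * f x + b * g x).
Hypothesis Phi_neq0 : Phi !=set0.

Lemma trig_bounded F : trig_class F -> exists M, forall x, `|F x| <= M.
Proof.
elim=> {F} [f _|f _|a b F G _ [M MF] _ [N NG]|F_ G M _ _ FM FG].
- by exists 1 => x; rewrite ler_norml cos_geN1 cos_le1.
- by exists 1 => x; rewrite ler_norml sin_geN1 sin_le1.
- exists (`|a| * M + `|b| * N) => x.
  by rewrite (le_trans (ler_normD _ _))// !normrM lerD// ler_wpM2l.
- exists M => x; have h : `|F_ n x| @[n --> \oo] --> `|G x| by exact: cvg_norm.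
  rewrite -(cvg_lim _ h)//; apply: limr_le; first by apply/cvg_ex; exists `|G x|.
  by apply: nearW.
Qed.

Lemma trig_scale a F : trig_class F -> trig_class (fun x => a * F x).
Proof.
move=> tF; have := trig_lin a 0 tF tF; congr trig_class.
by apply/funext => x; rewrite mul0r addr0.
Qed.

(** The limit case of the inductions in [trig_mul]: [F] is bounded, so the products stay uniformly
    bounded. *)
Lemma trig_mul_lim F (G_ : nat -> T -> R) G M : trig_class F ->
  (forall n, trig_class (fun x => F x * G_ n x)) ->
  (forall n x, `|G_ n x| <= M) ->
  (forall x, G_ n x @[n --> \oo] --> G x) ->
  trig_class (fun x => F x * G x).
Proof.
move=> tF tFG GM GG; have [N FN] := trig_bounded tF.
apply: (@trig_lim (fun n x => F x * G_ n x) _ (N * M)) => //.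
  by move=> n x; rewrite normrM ler_pM.
by move=> x; apply: cvgMr; exact: GG.
Qed.

Let PhiD f g : Phi f -> Phi g -> Phi (fun x => f x + g x).
Proof.
move=> Pf Pg; have := Phi_lin 1 1 Pf Pg; congr Phi.
by apply/funext => x; rewrite !mul1r.
Qed.

Let PhiB f g : Phi f -> Phi g -> Phi (fun x => f x - g x).
Proof.
move=> Pf Pg; have := Phi_lin 1 (-1) Pf Pg; congr Phi.
by apply/funext => x; rewrite !mul1r mulN1r.
Qed.

(** A double induction whose base cases are the product-to-sum formulas, [Phi] being stable under
    sums and differences. *)
Lemma trig_mul F G : trig_class F -> trig_class G ->
  trig_class (fun x => F x * G x).
Proof.
move=> tF; elim: tF G => {F} [f Pf|f Pf|a b F1 F2 _ IH1 _ IH2|F_ F M _ IH FM FF] G tG.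
- elim: tG => {G} [g Pg|g Pg|a b F G _ IHF _ IHG|G_ G M _ IH GM GG].
  + have := trig_lin 2^-1 2^-1 (trig_cos (PhiD Pf Pg)) (trig_cos (PhiB Pf Pg)).
    by congr trig_class; apply/funext => x; rewrite cosD cosB; field.
  + have := trig_lin 2^-1 (- 2^-1) (trig_sin (PhiD Pf Pg)) (trig_sin (PhiB Pf Pg)).
    by congr trig_class; apply/funext => x; rewrite sinD sinB; field.
  + have := trig_lin a b IHF IHG.
    by congr trig_class; apply/funext => x; ring.
  + exact: (trig_mul_lim (trig_cos Pf) IH GM GG).
- elim: tG => {G} [g Pg|g Pg|a b F G _ IHF _ IHG|G_ G M _ IH GM GG].
  + have := trig_lin 2^-1 2^-1 (trig_sin (PhiD Pf Pg)) (trig_sin (PhiB Pf Pg)).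
    by congr trig_class; apply/funext => x; rewrite sinD sinB; field.
  + have := trig_lin 2^-1 (- 2^-1) (trig_cos (PhiB Pf Pg)) (trig_cos (PhiD Pf Pg)).
    by congr trig_class; apply/funext => x; rewrite cosB cosD; field.
  + have := trig_lin a b IHF IHG.
    by congr trig_class; apply/funext => x; ring.
  + exact: (trig_mul_lim (trig_sin Pf) IH GM GG).
- have := trig_lin a b (IH1 _ tG) (IH2 _ tG).
  by congr trig_class; apply/funext => x; ring.
- rewrite (_ : (fun _ => _) = (fun x => G x * F x)); last first.
    by apply/funext => x; rewrite mulrC.
  apply: (trig_mul_lim tG _ FM FF) => n; have := IH n _ tG.
  by congr trig_class; apply/funext => x; rewrite mulrC.
Qed.

Lemma trig_cst (c : R) : trig_class (fun=> c).
Proof.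
have [f Pf] := Phi_neq0.
have := trig_scale c (trig_cos (Phi_lin 0 0 Pf Pf)); congr trig_class.
by apply/funext => x; rewrite !mul0r addr0 cos0 mulr1.
Qed.

Lemma trig_exp F n : trig_class F -> trig_class (fun x => F x ^+ n).
Proof.
move=> tF; elim: n => [|n IH]; first exact: trig_cst.
have := trig_mul tF IH; congr trig_class.
by apply/funext => x; rewrite exprS.
Qed.

Lemma trig_indicC A : trig_class \1_A -> trig_class \1_(~` A).
Proof.
move=> tA; have := trig_lin 1 (-1) (trig_cst 1) tA; congr trig_class.
apply/funext => x; rewrite !indicE in_setC.
by case: (x \in A); rewrite /=; lra.
Qed.

Lemma trig_indicI A B : trig_class \1_A -> trig_class \1_B ->
  trig_class \1_(A `&` B).
Proof.
move=> tA tB; have := trig_mul tA tB; congr trig_class.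
by apply/funext => x; rewrite !indicE in_setI -natrM mulnb.
Qed.

Lemma norm_indic_le1 A (x : T) : `|\1_A x : R| <= 1.
Proof. by rewrite indicE; case: (x \in A); rewrite ?normr1 ?normr0. Qed.

(** Finite unions come from complements and intersections; at each point their indicators are
    eventually constant. *)
Lemma trig_indic_bigcup (A : nat -> set T) : (forall n, trig_class \1_(A n)) ->
  trig_class \1_(\bigcup_n A n).
Proof.
move=> tA.
have tU n : trig_class \1_(\big[setU/set0]_(i < n) A i).
  elim: n => [|n IH].
    rewrite big_ord0 (_ : \1_set0 = (fun=> 0)); first exact: trig_cst.
    by apply/funext => x; rewrite indic0.
  rewrite big_ord_recr/= -[X in \1_X]setCK setCU.
  by apply: trig_indicC; apply: trig_indicI; exact: trig_indicC.
apply: (trig_lim tU (fun n => @norm_indic_le1 _)) => x.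
rewrite [in X in _ --> X]indicE.
have [/set_mem [k _ Akx]|nA] := boolP (x \in _); apply: cvg_near_cst.
  near=> n; rewrite indicE mem_set// -bigcup_mkord; exists k => //=.
  by near: n; exact: nbhs_infty_gt.
apply: nearW => n; rewrite indicE memNset// -bigcup_mkord => -[k _ Akx].
by move/negP: nA; apply; apply/mem_set; exists k.
Unshelve. all: by end_near. Qed.

(** The function [y = (1 + sin (f - c)) / 2] is valued in [0, 1] and below 1/2 exactly on the event,
    so the polynomials of [cvg_step] in [y] tend to its indicator. *)
Lemma trig_indic_sin_lt0 f c : Phi f -> trig_class \1_[set x | sin (f x - c) < 0].
Proof.
move=> Pf.
pose y x := 2^-1 * 1 + 2^-1 * sin (f x - c).
have ty : trig_class y.
  apply: trig_lin; first exact: trig_cst.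
  have := trig_lin (cos c) (- sin c) (trig_sin Pf) (trig_cos Pf).
  by congr trig_class; apply/funext => x; rewrite sinB; ring.
have y01 x : 0 <= y x <= 1.
  have := sin_geN1 (f x - c); have := sin_le1 (f x - c); rewrite /y => ? ?.
  by apply/andP; split; lra.
apply: (@trig_lim (fun n x => (1 - y x ^+ n) ^+ (n * 2 ^ n)) _ 1).
- move=> n; apply: trig_exp.
  have := trig_lin 1 (-1) (trig_cst 1) (trig_exp n ty); congr trig_class.
  by apply/funext => x; ring.
- move=> n x; have /andP[y0 y1] := y01 x.
  have yn0 : 0 <= 1 - y x ^+ n by rewrite subr_ge0 exprn_ile1.
  rewrite ger0_norm ?exprn_ge0// exprn_ile1//.
  by rewrite lerBlDr lerDl exprn_ge0.
- move=> x; rewrite indicE (_ : (x \in _) = (y x < 2^-1)); first exact: cvg_step.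
  rewrite /y; apply/idP/idP => [/set_mem /= h|h]; first by lra.
  by apply/mem_set => /=; lra.
Qed.

(* The event f < c is the limit of the events sin ((f - c) / (n + 1)) < 0. *)
Lemma trig_indic_lt f c : Phi f -> trig_class \1_[set x | f x < c].
Proof.
move=> Pf.
have tn n : trig_class \1_[set x | sin (n.+1%:R^-1 * (f x - c)) < 0].
  have := @trig_indic_sin_lt0 _ (n.+1%:R^-1 * c) (Phi_lin n.+1%:R^-1 0 Pf Pf).
  congr trig_class; congr (\1_ _).
  by apply/funext => x /=; rewrite mul0r addr0 mulrBr.
apply: (trig_lim tn (fun n => @norm_indic_le1 _)) => x.
apply: cvg_near_cst; near=> n.
(* For large [n] the argument lies in (-pi, pi), where sine has the sign of its argument. *)
have hn : n.+1%:R^-1 * `|f x - c| < pi.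
  rewrite mulrC ltr_pdivrMr// -ltr_pdivrMl ?pi_gt0//.
  rewrite (@lt_le_trans _ _ n%:R) ?ler_nat//.
  by near: n; exact: nbhs_infty_gtr.
rewrite !indicE; congr ((nat_of_bool _)%:R).
have n0 : 0 < (n.+1%:R^-1 : R) by rewrite invr_gt0.
apply/idP/idP => /set_mem /= h; apply/mem_set => /=.
  rewrite ltNge; apply/negP => cf; move: h; apply/negP; rewrite -leNgt.
  apply: sin_ge0_pi; move: hn; rewrite ger0_norm ?subr_ge0// => hn.
  by rewrite (ltW hn) mulr_ge0 ?subr_ge0 ?(ltW n0).
rewrite -oppr_gt0 -sinN; apply: sin_gt0_pi.
move: hn; rewrite ltr0_norm ?subr_lt0// mulrN => ->.
by rewrite andbT oppr_gt0 pmulr_rlt0// subr_lt0.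
Unshelve. all: by end_near. Qed.

End trig_class.

Lemma integrable_bounded d (T : measurableType d) (R : realType)
    (P : probability T R) (F : T -> R) M :
  measurable_fun setT F -> (forall x, `|F x| <= M) ->
  P.-integrable setT (EFin \o F).
Proof.
move=> mF FM; apply: (@le_integrable _ _ _ _ _ _ _ (cst M%:E)) => //.
- exact/measurable_EFinP.
- move=> x _ /=; rewrite lee_fin (le_trans (FM x))// ler_norm//.
- exact: finite_measure_integrable_cst.
Qed.

(** * Probabilities determined by trigonometric integrals *)

Section cramer_wold.
Context d (T : measurableType d) (R : realType) (P Q : probability T R).
Variable Phi : set (T -> R).
Hypothesis Phi_lin : forall a b f g, Phi f -> Phi g ->
  Phi (fun x => a * f x + b * g x).
Hypothesis Phi_neq0 : Phi !=set0.
Hypothesis Phi_meas : forall f, Phi f -> measurable_fun setT f.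
Hypothesis cosPQ : forall f, Phi f ->
  (\int[P]_x (cos (f x))%:E = \int[Q]_x (cos (f x))%:E)%E.
Hypothesis sinPQ : forall f, Phi f ->
  (\int[P]_x (sin (f x))%:E = \int[Q]_x (sin (f x))%:E)%E.

Lemma trig_measurable F : trig_class Phi F -> measurable_fun setT F.
Proof.
elim=> {F} [f Pf|f Pf|a b F G _ mF _ mG|F_ G M _ mF FM FG].
- apply: measurableT_comp; last exact: Phi_meas.
  exact: continuous_measurable_fun (@continuous_cos R).
- apply: measurableT_comp; last exact: Phi_meas.
  exact: continuous_measurable_fun (@continuous_sin R).
- by apply: measurable_funD; apply: measurable_funM.
- by apply: (measurable_fun_cvg mF) => x _; exact: FG.
Qed.

Lemma trig_integrable (mu : probability T R) F : trig_class Phi F ->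
  mu.-integrable setT (EFin \o F).
Proof.
move=> tF; have [M FM] := trig_bounded tF.
exact: integrable_bounded (trig_measurable tF) FM.
Qed.

Lemma trig_integral F : trig_class Phi F ->
  (\int[P]_x (F x)%:E = \int[Q]_x (F x)%:E)%E.
Proof.
elim=> {F} [f Pf|f Pf|a b F G tF IF tG IG|F_ G M tF IF FM FG].
- exact: cosPQ.
- exact: sinPQ.
- have intE (mu : probability T R) : (\int[mu]_x (a * F x + b * G x)%:E =
      a%:E * \int[mu]_x (F x)%:E + b%:E * \int[mu]_x (G x)%:E)%E.
    under eq_integral do rewrite EFinD !EFinM.
    rewrite integralD//; last 2 first.
    + by apply: integrableZl => //; exact: trig_integrable.
    + by apply: integrableZl => //; exact: trig_integrable.
    by rewrite !integralZl//; exact: trig_integrable.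
  by rewrite !intE IF IG.
- have limE (mu : probability T R) :
      (\int[mu]_x (F_ n x)%:E)%E @[n --> \oo] --> (\int[mu]_x (G x)%:E)%E.
    have [] // := @dominated_convergence _ _ _ mu setT measurableT
      (fun n x => (F_ n x)%:E) (fun x => (G x)%:E) (cst M%:E).
    + by move=> n; apply/measurable_EFinP; exact: trig_measurable.
    + apply/measurable_EFinP; apply: (measurable_fun_cvg (h := F_)) => //.
      by move=> n; exact: trig_measurable.
    + by apply: aeW => x _; apply/fine_cvgP; split; [exact: nearW|exact: FG].
    + exact: finite_measure_integrable_cst.
    + by apply: aeW => x n _; rewrite lee_fin.
  have := limE Q; under eq_cvg do rewrite -IF.
  by move=> h; rewrite -(cvg_lim _ (limE P))// -(cvg_lim _ h).
Qed.

(** The sets whose indicator lies in [trig_class] form a sigma-algebra containing the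
    half-spaces. *)
Theorem cramer_wold A : measurable A ->
  <<s [set [set x | fc.1 x < fc.2] | fc in [set fc : (T -> R) * R | Phi fc.1]] >> A ->
  P A = Q A.
Proof.
move=> mA sA.
suff tA : trig_class Phi \1_A.
  by have := trig_integral tA; rewrite !integral_indic// setIT.
move: A sA {mA}; apply: smallest_sub; last first.
  by move=> _ [[f c] /= Pf <-]; exact: trig_indic_lt.
split.
- rewrite (_ : \1_set0 = (fun=> 0)); first exact: trig_cst.
  by apply/funext => x; rewrite indic0.
- by move=> A tA; rewrite setTD; exact: trig_indicC.
- by move=> A tA; exact: trig_indic_bigcup.
Qed.

End cramer_wold.

(** * Normal integrals *)

Section normal_integrals.
Context {R : realType}.
Local Notation leb := (@lebesgue_measure R).
Implicit Types (m s r a b x y z : R).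

(** The Radon-Nikodym derivative agrees almost everywhere with [normal_pdf], both having the same
    integral over every measurable set. *)
Lemma ge0_integral_normal_prob m s (f : R -> \bar R) : s != 0 ->
  measurable_fun setT f -> (forall x, 0 <= f x)%E ->
  (\int[normal_prob m s]_x f x = \int[leb]_x (f x * (normal_pdf m s x)%:E))%E.
Proof.
move=> s0 mf f0.
have dom := normal_prob_dominates m s.
rewrite -(@Radon_Nikodym_SigmaFinite.change_of_variables _ _ _ _ leb dom _ _ f0 measurableT mf).
apply: ae_eq_integral => //.
- apply: emeasurable_funM => //; apply: (measurable_int leb).
  exact: Radon_Nikodym_SigmaFinite.f_integrable.
- apply: emeasurable_funM => //; apply/measurable_EFinP.
  exact: measurable_normal_pdf.
- apply: ae_eqe_mul2l => /=; apply: integral_ae_eq => //=.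
  + exact: Radon_Nikodym_SigmaFinite.f_integrable.
  + by apply/measurable_EFinP; exact: measurable_normal_pdf.
  + by move=> A _ mA; rewrite -Radon_Nikodym_SigmaFinite.f_integral.
Qed.

Lemma integral_affine_substitution a b (G : R -> R) : 0 < a ->
  continuous G -> (forall x, 0 <= G x) ->
  (\int[leb]_x (G x)%:E = \int[leb]_x (G (a * x + b) * a)%:E)%E.
Proof.
move=> a0 cG G0.
pose F (x : R) := a * x + b.
have dF x : is_derive x 1 F a.
  rewrite /F; apply: is_derive_eq; rewrite addr0 -[RHS]mulr1.
  by [].
have F'E : F^`()%classic = cst a.
  by apply/funext => x; rewrite derive1E derive_val.
rewrite (@increasing_ge0_integration_by_substitutionT R F G)//.
- by rewrite F'E.
- by move=> x y xy; rewrite /F ltrD2r ltr_pM2l.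
- by rewrite F'E => ?; exact: cvg_cst.
- by rewrite F'E; exact: is_cvg_cst.
- by rewrite F'E; exact: is_cvg_cst.
- apply: (@cvg_comp _ _ _ (fun x => a * x) (fun x => x + b)); last exact: cvg_addrr_Ny.
  by apply/gt0_cvgMrNy => //; exact: cvg_id.
- apply: (@cvg_comp _ _ _ (fun x => a * x) (fun x => x + b)); last exact: cvg_addrr.
  by apply/gt0_cvgMry => //; exact: cvg_id.
Qed.

(** Completing the square in [x]: the density of the sum at [z] times the conditional density of the
    first summand given that sum. *)
Lemma normal_pdf_conv s r x z : s != 0 -> r != 0 ->
  let t := Num.sqrt (s ^+ 2 + r ^+ 2) in
  normal_pdf 0 s x * normal_pdf 0 r (z - x) =
  normal_pdf 0 t z * normal_pdf (z * s ^+ 2 / t ^+ 2) (s * r / t) x.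
Proof.
move=> s0 r0 t.
have s2 : 0 < s ^+ 2 by rewrite exprn_even_gt0.
have r2 : 0 < r ^+ 2 by rewrite exprn_even_gt0.
have t2 : t ^+ 2 = s ^+ 2 + r ^+ 2 by rewrite sqr_sqrtr// addr_ge0// ltW.
have t0 : t != 0 by rewrite gt_eqF// sqrtr_gt0 addr_gt0.
have sr0 : s * r / t != 0 by rewrite !mulf_neq0// invr_neq0.
rewrite !normal_pdfE// mulrACA [RHS]mulrACA; congr (_ * _).
  rewrite /normal_peak -!invfM; congr (_^-1).
  have h (u : R) : 0 <= u ^+ 2 * pi *+ 2.
    by rewrite mulrn_wge0// mulr_ge0 ?sqr_ge0 ?pi_ge0.
  rewrite -!sqrtrM//; congr Num.sqrt.
  by rewrite !exprMn exprVn; field; rewrite t0.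
rewrite /normal_fun -!expRD; congr expR.
rewrite !subr0 !exprMn exprVn.
move: t2 t0; move: (t) => T t2 t0.
have T2 : s ^+ 2 + r ^+ 2 != 0 by rewrite gt_eqF// addr_gt0.
by rewrite t2; field; rewrite T2 r0 s0.
Qed.

(* Integral against normal_law 0 s; normal_prob 0 0 is not the point mass at 0. *)
Definition normal_int s (u : R -> \bar R) : \bar R :=
  if s == 0 then u 0 else (\int[normal_prob 0 s]_x u x)%E.

(** After the shift [x] enters only through the density, which prepares the exchange of
    integrals. *)
Lemma integral_normal_pdf_shift r x (u : R -> R) : r != 0 ->
  continuous u -> (forall y, 0 <= u y) ->
  (\int[normal_prob 0 r]_y (u (x + y))%:E =
   \int[leb]_z (u z * normal_pdf 0 r (z - x))%:E)%E.
Proof.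
move=> r0 cu u0.
have cux : continuous (fun y => u (x + y)).
  move=> y; apply: (@continuous_comp _ _ _ (fun y => x + y) u); last exact: cu.
  by apply: cvgD; [exact: cvg_cst|exact: cvg_id].
rewrite ge0_integral_normal_prob//; last 2 first.
- by apply/measurable_EFinP; exact: continuous_measurable_fun.
- by move=> y; rewrite lee_fin.
rewrite (@integral_affine_substitution 1 (- x) (fun y => u (x + y) * normal_pdf 0 r y))//.
- by apply: eq_integral => z _; rewrite mul1r mulr1 addrC subrK addrC.
- by move=> y; apply: cvgM; [exact: cux|exact: continuous_normal_pdf].
- by move=> y; rewrite mulr_ge0// normal_pdf_ge0.
Qed.

(** Tonelli reduces this to [normal_pdf_conv], whose last factor has integral 1 in [x]; a zero
    deviation turns one integral into an evaluation. *)
Lemma normal_int_add s r (u : R -> R) : 0 <= s -> 0 <= r ->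
  continuous u -> (forall x, 0 <= u x) ->
  normal_int s (fun x => normal_int r (fun y => (u (x + y))%:E)) =
  normal_int (Num.sqrt (s ^+ 2 + r ^+ 2)) (EFin \o u).
Proof.
move=> sge0 rge0 cu u0; rewrite /normal_int; have [->|s0] := eqVneq s 0.
  rewrite (_ : Num.sqrt _ = r) ?add0r; last first.
    by rewrite expr0n add0r sqrtr_sqr ger0_norm.
  by under eq_integral do rewrite add0r.
have [->|r0] := eqVneq r 0.
  rewrite (_ : Num.sqrt _ = s) ?(negbTE s0); last first.
    by rewrite expr0n addr0 sqrtr_sqr ger0_norm.
  by under eq_integral do rewrite addr0.
set t := Num.sqrt _.
have t0 : t != 0.
  by rewrite gt_eqF// sqrtr_gt0 addr_gt0// exprn_even_gt0.
rewrite (negbTE t0).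
have mu' : measurable_fun setT u by exact: continuous_measurable_fun.
pose K (p : measurableTypeR R * measurableTypeR R) :=
  (u p.2 * normal_pdf 0 r (p.2 - p.1))%:E.
have mK : measurable_fun setT K.
  apply/measurable_EFinP; apply: measurable_funM.
    exact: measurableT_comp.
  apply: measurableT_comp; first exact: measurable_normal_pdf.
  exact: measurable_funB.
have K0 p : (0 <= K p)%E by rewrite lee_fin mulr_ge0// normal_pdf_ge0.
pose H (p : measurableTypeR R * measurableTypeR R) :=
  (K p * (normal_pdf 0 s p.1)%:E)%E.
have mH : measurable_fun setT H.
  apply: emeasurable_funM => //; apply/measurable_EFinP.
  by apply: measurableT_comp; first exact: measurable_normal_pdf.
have H0 p : (0 <= H p)%E by rewrite mule_ge0// lee_fin normal_pdf_ge0.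
have mKx x : measurable_fun setT (fun z => K (x, z)).
  exact: measurableT_comp.
transitivity (\int[normal_prob 0 s]_x \int[leb]_z K (x, z))%E.
  by apply: eq_integral => x _; rewrite integral_normal_pdf_shift.
rewrite ge0_integral_normal_prob//; last 2 first.
- exact: measurable_fun_fubini_tonelli_F.
- by move=> x; apply: integral_ge0.
transitivity (\int[leb]_x \int[leb]_z H (x, z))%E.
  apply: eq_integral => x _; rewrite /H /=; apply/esym; apply: ge0_integralZr => //.
    exact: mKx.
  by rewrite lee_fin normal_pdf_ge0.
transitivity (\int[leb]_z \int[leb]_x H (x, z))%E.
  exact: (fubini_tonelli H).
have u0' x : (0 <= (EFin \o u) x)%E by rewrite /= lee_fin.
have mu'' : measurable_fun setT (EFin \o u) by exact/measurable_EFinP.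
rewrite (ge0_integral_normal_prob _ t0 mu'' u0').
apply: eq_integral => z _; rewrite /H /K/=.
under eq_integral => x _.
  rewrite -EFinM -mulrA [normal_pdf _ _ _ * _]mulrC normal_pdf_conv// mulrA EFinM.
  over.
rewrite ge0_integralZl//; last 3 first.
- by apply/measurable_EFinP; exact: measurable_normal_pdf.
- by move=> x _; rewrite lee_fin normal_pdf_ge0.
- by rewrite lee_fin mulr_ge0// normal_pdf_ge0.
by rewrite integral_normal_pdf mule1.
Qed.

(** Serves to compare variances through second moments: by [normal_int_sqr_gt0] and
    [normal_int_sqr_lty] the common factor can be cancelled. *)
Lemma normal_int_sqr s : 0 <= s ->
  normal_int s (fun x => (x ^+ 2)%:E) =
  ((s ^+ 2)%:E * normal_int 1 (fun x => (x ^+ 2)%:E))%E.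
Proof.
rewrite /normal_int oner_eq0; have [->|s0] := eqVneq s 0.
  by rewrite !expr0n/= mul0e.
rewrite le0r (negbTE s0)/= => sgt0.
have mX2 : measurable_fun setT (fun x : R => (x ^+ 2)%:E).
  by apply/measurable_EFinP; exact: measurable_funX.
have X20 x : (0 <= (x ^+ 2)%:E)%E by rewrite lee_fin sqr_ge0.
rewrite !ge0_integral_normal_prob ?oner_eq0//.
rewrite (@integral_affine_substitution s 0 (fun x => x ^+ 2 * normal_pdf 0 s x))//.
- rewrite -ge0_integralZl ?lee_fin ?sqr_ge0//.
  + apply: eq_integral => x _; rewrite addr0 -!EFinM; congr EFin; rewrite /=.
    rewrite !normal_pdfE ?oner_eq0//.
    have -> : normal_peak 1 = normal_peak s * s.
      rewrite /normal_peak expr1n mul1r -mulrnAr sqrtrM ?sqr_ge0//.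
      by rewrite sqrtr_sqr gtr0_norm// invfM mulrAC mulVf ?mul1r.
    have -> : normal_fun 0 s (s * x) = normal_fun 0 1 x.
      by rewrite /normal_fun; congr expR; rewrite !subr0; field; rewrite s0.
    by ring.
  + apply: emeasurable_funM => //; apply/measurable_EFinP.
    exact: measurable_normal_pdf.
  + by move=> x _; rewrite mule_ge0// lee_fin normal_pdf_ge0.
- move=> x; apply: cvgM; last exact: continuous_normal_pdf.
  exact: sqr_continuous.
- by move=> x; rewrite mulr_ge0 ?sqr_ge0// normal_pdf_ge0.
Qed.

Let mX2 : measurable_fun setT (fun x : R => (x ^+ 2)%:E).
Proof. by apply/measurable_EFinP; exact: measurable_funX. Qed.

Let X20 x : (0 <= (x ^+ 2)%:E)%E.
Proof. by rewrite lee_fin sqr_ge0. Qed.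

Lemma normal_int_sqr_gt0 : (0 < normal_int 1 (fun x => (x ^+ 2)%:E))%E.
Proof.
rewrite /normal_int oner_eq0 ge0_integral_normal_prob ?oner_eq0//.
have p2 : 0 < normal_pdf 0 1 (2 : R).
  by rewrite normal_pdfE ?oner_eq0// mulr_gt0 ?expR_gt0 ?normal_peak_gt0 ?oner_eq0.
apply: (@lt_le_trans _ _ (\int[leb]_(x in `[1%R, 2%R]) (normal_pdf 0 1 (2 : R))%:E)%E).
  rewrite integral_cst//= lebesgue_measure_itv/= lte_fin ltr1n/=.
  by rewrite -EFinB mule_gt0// lte_fin//; lra.
apply: (@le_trans _ _ (\int[leb]_(x in `[1%R, 2%R]) ((x ^+ 2)%:E * (normal_pdf 0 1 x)%:E))%E).
  apply: ge0_le_integral => //.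
  - by move=> x _; rewrite lee_fin ltW.
  - apply: measurable_funTS; apply: emeasurable_funM => //.
    by apply/measurable_EFinP; exact: measurable_normal_pdf.
  - move=> x /=; rewrite in_itv/= => /andP[x1 x2]; rewrite -EFinM lee_fin.
    rewrite -[leLHS]mul1r ler_pM//; first by rewrite ltW.
      by rewrite exprn_ege1.
    rewrite !normal_pdfE ?oner_eq0// ler_wpM2l ?normal_peak_ge0//.
    rewrite ler_expR !subr0 ler_pM2r ?invr_gt0 ?expr1n ?mulrn_wgt0//.
    by rewrite lerN2 ler_pXn2r// nnegrE; lra.
apply: ge0_subset_integral => //.
- apply: emeasurable_funM => //; apply/measurable_EFinP.
  exact: measurable_normal_pdf.
- by move=> x _; rewrite mule_ge0// lee_fin normal_pdf_ge0.
Qed.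

Lemma normal_int_sqr_lty : (normal_int 1 (fun x => (x ^+ 2)%:E) < +oo)%E.
Proof.
rewrite /normal_int oner_eq0 ge0_integral_normal_prob ?oner_eq0//.
(* From [1 + 3 / 8 * x ^+ 2 <= exp (3 / 8 * x ^+ 2)] follows [x ^+ 2 * exp (- x ^+ 2 / 2) <= 8 / 3 *
   exp (- x ^+ 2 / 8)]; [c] also absorbs the ratio of the peaks. *)
pose c : R := normal_peak 1 * (3 / 8)^-1 / normal_peak 2.
have p1 : 0 < normal_peak (1 : R) by rewrite normal_peak_gt0 ?oner_eq0.
have p2 : 0 < normal_peak (2 : R) by rewrite normal_peak_gt0.
apply: (@le_lt_trans _ _ (\int[leb]_x (c%:E * (normal_pdf 0 2 x)%:E))%E).
  apply: ge0_le_integral => //.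
  - by move=> x _; rewrite mule_ge0// lee_fin normal_pdf_ge0.
  - apply: emeasurable_funM => //; apply/measurable_EFinP.
    exact: measurable_normal_pdf.
  - apply: emeasurable_funM => //; apply/measurable_EFinP.
    exact: measurable_normal_pdf.
  - move=> x _; rewrite -!EFinM lee_fin !normal_pdfE ?oner_eq0//.
    have -> : c * (normal_peak 2 * normal_fun 0 2 x) =
        normal_peak 1 * ((3 / 8)^-1 * normal_fun 0 2 x).
      by rewrite /c mulrA divfK ?gt_eqF// mulrA.
    rewrite mulrCA ler_pM2l// ler_pdivlMl ?divr_gt0//.
    rewrite /normal_fun !subr0.
    rewrite (_ : - x ^+ 2 / (2 ^+ 2 *+ 2) =
      3 / 8 * x ^+ 2 + - x ^+ 2 / (1 ^+ 2 *+ 2)); last by field.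
    rewrite expRD mulrA ler_pM2r ?expR_gt0//.
    by rewrite (le_trans _ (expR_ge1Dx _))// lerDr.
rewrite ge0_integralZl//; last 3 first.
- by apply/measurable_EFinP; exact: measurable_normal_pdf.
- by move=> x _; rewrite lee_fin normal_pdf_ge0.
- by rewrite lee_fin /c divr_ge0 ?(ltW p2)// mulr_ge0 ?(ltW p1)// invr_ge0 divr_ge0.
by rewrite integral_normal_pdf mule1 ltry.
Qed.

End normal_integrals.

(** * The Borel sigma-algebra of a separable Banach space *)

Section separable_borel.
Context {R : realType} {E : completeNormedModType R}.
Hypothesis Esep : separable E.

Lemma separable_sequence : exists x_ : nat -> E,
  forall y e, 0 < e -> exists n, ball y e (x_ n).
Proof.
have [D cD dD] := Esep.
have /countable_injP[g ginj] := cD.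
(* For [n] outside the range of [g] on [D] the condition is void, and 0 is taken. *)
have gE n : exists x, forall z, D z -> g z = n -> z = x.
  have [[z [Dz gz]]|nz] := pselect (exists z, D z /\ g z = n).
    exists z => w Dw gw; apply: ginj; [exact/mem_set|exact/mem_set|].
    by rewrite gw gz.
  by exists 0 => z Dz gz; exfalso; apply: nz; exists z.
have [x_ x_P] := choice gE.
exists x_ => y e e0.
have [z [yz Dz]] := dD (ball y e) (ex_intro _ y (ballxx y e0)) (ball_open y e).
by exists (g z); rewrite -(x_P _ z).
Qed.

(* The functionals norming a dense sequence recover the norm as a supremum, so closed
   balls, hence open sets, belong to the sigma-algebra of the dual. *)
Lemma open_dual_sigma_algebra (S : set (set E)) : sigma_algebra setT S ->
  (forall (f : {linear E -> R^o}) c, continuous f -> S [set x | f x < c]) ->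
  open `<=` S.
Proof.
move=> [S0 SC SU] Sf.
have {}SC A : S A -> S (~` A) by rewrite -setTD; exact: SC.
have SI (A : nat -> set E) : (forall n, S (A n)) -> S (\bigcap_n A n).
  by move=> SA; rewrite -[\bigcap_n _]setCK setC_bigcap; apply/SC/SU => n; exact: SC.
have [x_ dx] := separable_sequence.
have [f_ f_P] := choice (fun n => norming_functional (x_ n)).
(* If [x_ n] is within [e / 2] of [x], then [|x_ n|] differs from both [f_ n x] and [|x|] by at most
   [e / 2]. *)
have normE x r : (forall n, f_ n x <= r) -> `|x| <= r.
  move=> h; apply/ler_addgt0Pr => e e0.
  have e20 : 0 < e / 2 by rewrite divr_gt0.
  have [n] := dx x _ e20; rewrite -ball_normE/= => xn.
  have [_ fn fx] := f_P n.
  have := fn (x_ n - x); rewrite raddfB/= fx [leRHS]distrC => h1.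
  have h2 := ler_norm (`|x_ n| - f_ n x).
  have h3 := ler_normD (x - x_ n) (x_ n); rewrite subrK in h3.
  have := h n; lra.
have Scball y r : S [set x | `|x - y| <= r].
  (* Only strict sublevel sets are given, so [f_ n x <= r + f_ n y] is written as the complement of
     one for [- f_ n]. *)
  have -> : [set x | `|x - y| <= r] = \bigcap_n ~` [set x | - f_ n x < - (r + f_ n y)].
    apply/seteqP; split=> x /= h.
      move=> n _ /=; apply/negP; rewrite -leNgt lerN2 -lerBlDr -raddfB.
      have [_ fn _] := f_P n.
      by rewrite (le_trans (ler_norm _))// (le_trans (fn _)).
    apply: normE => n; have /= := h n I => /negP; rewrite -leNgt lerN2 -lerBlDr.
    by rewrite raddfB.
  apply: SI => n; apply: SC.
  have := Sf (\- f_ n) (- (r + f_ n y)); apply.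
  by have [cf _ _] := f_P n; move=> x; apply: cvgN; exact: cf.
move=> U oU.
pose B n m := [set x : E | `|x - x_ n| <= m.+1%:R^-1].
(* An open set is the countable union of the closed balls [B n m] that it contains. *)
have -> : U = \bigcup_n \bigcup_m (if `[< B n m `<=` U >] then B n m else set0).
  apply/seteqP; split=> [x Ux|x [n _ [m _]]]; last first.
    by case: ifPn => // /asboolP; exact.
  have /nbhs_ballP[e /= e0 eU] : nbhs x U by exact: open_nbhs_nbhs.
  have e20 : 0 < e / 2 by rewrite divr_gt0.
  have [m _ /(_ m (leqnn m)) /= me] := near_infty_natSinv_lt (PosNum e20).
  have [|n] := dx x m.+1%:R^-1; first by rewrite invr_gt0 ltr0n.
  rewrite -ball_normE/= => xn.
  exists n => //; exists m => //.
  have -> : `[< B n m `<=` U >] = true.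
    apply/asboolP => z; rewrite /B/= => zn; apply: eU; rewrite -ball_normE/=.
    rewrite (le_lt_trans (ler_distD (x_ n) _ _))//.
    rewrite [ltRHS]splitr ltr_leD//; first exact: lt_trans xn me.
    by rewrite distrC (le_trans zn)// ltW.
  by rewrite /B/= ltW.
by apply: (SU) => n; apply: (SU) => m; case: ifP => _; [exact: Scball|exact: S0].
Qed.

End separable_borel.

(** * Tightness *)

Section compact_sets.
Context {R : realType} {E : completeNormedModType R}.
Implicit Types (K F : set E) (x y z : E).

(** The single condition [|s| + |t| <= 1] combines convexity, symmetry and stability under
    contraction. *)
Definition absconvex K := forall x y (s t : R), K x -> K y ->
  `|s| + `|t| <= 1 -> K (s *: x + t *: y).

Definition totally_bounded K := forall e : R, 0 < e ->
  exists s : seq E, K `<=` [set x | exists2 y, y \in s & `|x - y| < e].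

(** An ultrafilter containing [K] contains, for each radius, one of finitely many covering balls; it
    is thus Cauchy and converges by completeness. *)
Lemma totally_bounded_compact K : closed K -> totally_bounded K -> compact K.
Proof.
move=> cK tK; rewrite compact_ultra => F FU FK.
have Fcauchy : cauchy F.
  apply: cauchy_exP => e e0; have [s Ks] := tK e e0.
  have : F [set x | exists2 y, y \in s & `|x - y| < e] by apply: filterS FK.
  elim: s {Ks} => [|y s IH] Fs.
    have [x []] := filter_ex Fs => //.
  have [Fy|Fy] := in_ultra_setVsetC (ball y e) FU; first by exists y.
  apply: IH; apply: filterS2 Fs Fy => x [z].
  rewrite in_cons => /predU1P[->|zs] xz; last by exists z.
  by rewrite -ball_normE/= distrC.
have Fp : cvg F by exact: cauchy_cvg.
exists (lim F); split => //; apply: cK => U Up.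
exact: filter_ex (filterI FK (Fp U Up)).
Qed.

(** The Minkowski sum of the segments from [- a_ i] to [a_ i], [i < n]; adding one segment at a time
    makes compactness and absolute convexity simple inductions. *)
Fixpoint zonotope (a_ : nat -> E) n : set E :=
  if n is n'.+1 then
    [set y.1 + y.2 *: a_ n' | y in zonotope a_ n' `*` [set t : R | -1 <= t <= 1]]
  else [set 0].

Lemma zonotope_compact a_ n : compact (zonotope a_ n).
Proof.
elim: n => [|n IH] /=; first exact: compact_set1.
apply: continuous_compact; last first.
  apply: compact_setX => //.
  rewrite (_ : [set t : R | _] = `[-1, 1]%classic); first exact: segment_compact.
  by apply/seteqP; split=> t /=; rewrite in_itv.
apply: continuous_subspaceT => y; apply: cvgD; first exact: cvg_fst.
by apply: cvgZr_tmp; exact: cvg_snd.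
Qed.

Lemma zonotope_absconvex a_ n : absconvex (zonotope a_ n).
Proof.
elim: n => [|n IH] x y s t /=; first by move=> -> -> _; rewrite !scaler0 addr0.
move=> [[x' c] [/= Fx' c1] <-] [[y' b] [/= Fy' b1] <-] st.
exists (s *: x' + t *: y', s * c + t * b) => /=.
  split; first exact: IH.
  rewrite -ler_norml (le_trans (ler_normD _ _))// !normrM (le_trans _ st)//.
  by rewrite lerD// ler_piMr// ler_norml.
by rewrite !scalerDr !scalerA scalerDl addrACA.
Qed.

Lemma zonotope_mem a_ n m : (m < n)%N -> zonotope a_ n (a_ m).
Proof.
have Z0 k : zonotope a_ k 0.
  elim: k => [//|k IH] /=; exists (0, 0) => /=; last by rewrite scale0r addr0.
  by split=> //; rewrite lerN10 ler01.
elim: n => [//|n IH] /=; rewrite ltnS leq_eqVlt => /predU1P[->|mn].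
  exists (0, 1) => /=; last by rewrite scale1r add0r.
  by split=> //; rewrite lexx andbT; lra.
exists (a_ m, 0) => /=; last by rewrite scale0r addr0.
by split; [exact: IH|rewrite lerN10 ler01].
Qed.

Definition thickening F (e : R) : set E := [set x | exists2 y, F y & `|x - y| < e].

Lemma thickening_open F e : open (thickening F e).
Proof.
rewrite (_ : thickening F e = \bigcup_(y in F) ball y e).
  by apply: bigcup_open => y _; exact: ball_open.
apply/seteqP; split=> x /=.
  by move=> [y Fy xy]; exists y => //; rewrite -ball_normE/= distrC.
by move=> [y Fy]; rewrite -ball_normE/= distrC => xy; exists y.
Qed.

Lemma thickening_absconvex F e : absconvex F -> absconvex (thickening F e).
Proof.
move=> aF x y s t [x' Fx' xx'] [y' Fy' yy'] st.
have e0 : 0 < e by rewrite (le_lt_trans _ xx').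
exists (s *: x' + t *: y'); first exact: aF.
rewrite opprD addrACA -!scalerBr (le_lt_trans (ler_normD _ _))// !normrZ.
(* Strictness comes from a nonzero coefficient, hence the cases; when both vanish the bound is
   [0 < e]. *)
have [s0|s0] := eqVneq s 0; have [t0|t0] := eqVneq t 0.
- by rewrite s0 t0 normr0 !mul0r addr0.
- rewrite s0 normr0 mul0r add0r (le_lt_trans _ yy')// ler_piMl//.
  by move: st; rewrite s0 normr0 add0r.
- rewrite t0 normr0 mul0r addr0 (le_lt_trans _ xx')// ler_piMl//.
  by move: st; rewrite t0 normr0 addr0.
- apply: (@lt_le_trans _ _ (`|s| * e + `|t| * e)).
    by rewrite ltrD// ltr_pM2l// normr_gt0.
  by rewrite -mulrDl ler_piMl// ltW.
Qed.

Lemma compact_totally_bounded F : compact F -> totally_bounded F.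
Proof.
rewrite compact_cover => cF e e0.
have [||D _ FD] := cF E F (fun y => ball y e).
- by move=> y _; exact: ball_open.
- by move=> y Fy; exists y => //; exact: ballxx.
exists (finmap.enum_fset D) => x Fx; have [y Dy] := FD x Fx.
by rewrite -ball_normE/= distrC => xy; exists y.
Qed.

Lemma totally_bounded_closure K : totally_bounded K -> totally_bounded (closure K).
Proof.
move=> tK e e0; have e20 : 0 < e / 2 by rewrite divr_gt0.
have [s Ks] := tK _ e20; exists s => x cKx.
have [y [/Ks[z zs yz]]] := cKx _ (nbhsx_ballx x _ e20).
rewrite -ball_normE/= => xy; exists z => //.
rewrite (le_lt_trans (ler_distD y _ _))// [ltRHS]splitr.
by rewrite ltrD.
Qed.

End compact_sets.

Lemma borel_open (R : realType) (E : completeNormedModType R) (U : set E) :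
  open U -> measurable (U : set (borel E)).
Proof. by move=> oU; apply: sub_sigma_algebra. Qed.

(* Each open set D n is a neighbourhood of a zonotope, of radius 1/(n+1); as the
   zonotopes are compact, the intersection is totally bounded. *)
Lemma tight_absconvex (R : realType) (E : completeNormedModType R)
    (mu : probability (borel E) R) (e : R) : separable E -> 0 < e ->
  exists K : set E, [/\ measurable (K : set (borel E)), absconvex K,
    totally_bounded K & (mu (~` K) <= e%:E)%E].
Proof.
move=> Esep e0; have [a_ dense_a] := separable_sequence Esep.
pose T r N : set E := thickening (zonotope a_ N) r.
have mT r N : measurable (T r N : set (borel E)).
  by apply: borel_open; exact: thickening_open.
(* For a fixed radius the thickenings increase to the whole space, by density of [a_], so their
   measures tend to 1. *)
have T_big r d : 0 < r -> 0 < d -> exists N, (mu (~` T r N) <= d%:E)%E.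
  move=> r0 d0; apply: contrapT => /forallNP nN.
  have leN N : (mu (T r N) <= (1 - d)%:E)%E.
    have := nN N; rewrite probability_setC//.
    have := fin_num_measure mu _ (mT r N).
    move=> /fineK <-; move: (fine _) => p /negP; rewrite -ltNge -EFinB lte_fin lee_fin; lra.
  have TT : \bigcup_N T r N = setT.
    apply/seteqP; split=> // x _; have [n xn] := dense_a x r r0.
    exists n.+1 => //; exists (a_ n); first exact: zonotope_mem.
    by move: xn; rewrite -ball_normE.
  have ndT : {homo T r : n m / (n <= m)%N >-> (n <= m)%O}.
    apply: homo_leq => [n||n]; [exact: lexx|exact: le_trans|].
    apply/subsetPset => x [y Fy xy]; exists y => //.
    by exists (y, 0) => /=; rewrite ?scale0r ?addr0//; split; rewrite // lerN10 ler01.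
  have := @nondecreasing_cvg_mu _ _ _ mu (T r) (mT r).
  rewrite TT => /(_ measurableT ndT) cT.
  have : (mu setT <= (1 - d)%:E)%E.
    rewrite -(cvg_lim _ cT)//; apply: lime_le; first exact: (cvgP _ cT).
    by apply: nearW.
  by rewrite probability_setT lee_fin; lra.
have T_big' n : exists N,
    (mu (~` T (n.+1%:R^-1)%R N) <= (e / (2 ^ n.+1)%:R)%:E)%E.
  by apply: T_big; rewrite ?invr_gt0// divr_gt0// ltr0n expn_gt0.
have [N N_P] := choice T_big'.
pose D n := T n.+1%:R^-1 (N n).
exists (\bigcap_n D n); split.
- by apply: bigcapT_measurable => n; exact: mT.
- move=> x y s t Kx Ky st n _.
  exact: (thickening_absconvex (@zonotope_absconvex _ _ _ _) (Kx n I) (Ky n I) st).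
(* Half of [r] is spent on the thickening, half on a finite net of the compact zonotope. *)
- move=> r r0; have r20 : 0 < r / 2 by rewrite divr_gt0.
  have [n _ /(_ n (leqnn n)) /= nr] := near_infty_natSinv_lt (PosNum r20).
  have [s Fs] := compact_totally_bounded (@zonotope_compact _ _ a_ (N n)) r20.
  exists s => x /(_ n I) [y /Fs[z zs yz] xy]; exists z => //.
  rewrite (le_lt_trans (ler_distD y _ _))// [ltRHS]splitr ltrD//.
  exact: lt_trans xy nr.
- rewrite setC_bigcap.
  apply: (@le_trans _ _ (\sum_(n <oo) mu (~` D n))%E).
    apply: measure_sigma_subadditive => //.
    + by move=> n; apply: measurableC; exact: mT.
    + by apply: bigcupT_measurable => n; apply: measurableC; exact: mT.
  apply: le_trans (epsilon_trick0 _ (ltW e0)); apply: lee_nneseries => // n _; exact: N_P.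
Qed.

(** * Rotation invariance *)

Section gaussian_rotation.
Context {R : realType} {E : completeNormedModType R}.
Hypothesis Esep : separable E.
Variable mu : probability (borel E) R.
Hypothesis mu_gauss : centered_gaussian mu.

Lemma continuous_borel_measurable (g : E -> R) : continuous g ->
  measurable_fun setT (g : borel E -> measurableTypeR R).
Proof.
move=> cg; apply: (measurability _ (RGenOpens.measurableE R)).
move=> _ [_ [a [b ->]] <-]; rewrite setTI; apply: borel_open.
by move/continuousP : cg; apply; exact: interval_open.
Qed.

(** The law is expressed through integrals of nonnegative functions, the form Tonelli uses;
    [normal_int] covers the degenerate case. *)
Definition normal_under (g : E -> R) (s : R) := 0 <= s /\
  forall u : R -> \bar R, measurable_fun setT u -> (forall x, 0 <= u x)%E ->
    (\int[mu]_x u (g x) = normal_int s u)%E.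

Lemma gaussian_normal_under (g : {linear E -> R^o}) : continuous g ->
  exists s, normal_under g s.
Proof.
move=> cg; have [s s0 gs] := mu_gauss cg; exists s; split => // u mu' u0.
have mg : measurable_fun setT (g : borel E -> measurableTypeR R).
  exact: continuous_borel_measurable.
transitivity (\int[pushforward mu (g : borel E -> measurableTypeR R)]_y u y)%E.
  by rewrite ge0_integral_pushforward// preimage_setT.
move: gs; rewrite /normal_law /normal_int; have [_|_] := eqVneq s 0 => gs.
  rewrite (@eq_measure_integral _ _ _ _ (\d_(0 : measurableTypeR R))); last first.
    by move=> A mA _; exact: gs.
  by rewrite integral_dirac// diracT mul1e.
by apply: eq_measure_integral => A mA _; exact: gs.
Qed.

(** By Tonelli, [g X + h Y] with [X] and [Y] independent follows the convolution of two normal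
    laws. *)
Lemma integral_normal_sum (g h : E -> R) s r (u : R -> R) :
  continuous g -> continuous h -> normal_under g s -> normal_under h r ->
  continuous u -> (forall x, 0 <= u x) ->
  (\int[mu \x mu]_p (u (g p.1 + h p.2))%:E =
   normal_int (Num.sqrt (s ^+ 2 + r ^+ 2)) (EFin \o u))%E.
Proof.
move=> cg ch [s0 gs] [r0 hr] cu u0.
have mu' : measurable_fun setT u by exact: continuous_measurable_fun.
have mg := continuous_borel_measurable cg.
have mh := continuous_borel_measurable ch.
rewrite fubini_tonelli1//; last 2 first.
- apply/measurable_EFinP; apply: (measurableT_comp mu').
  by apply: measurable_funD; apply: measurableT_comp.
- by move=> p; rewrite lee_fin.
rewrite /fubini_F/= -normal_int_add//.
have mux (x : R) : measurable_fun setT (fun y : R => (u (x + y))%:E).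
  apply/measurable_EFinP; apply: (measurableT_comp mu').
  exact: measurable_funD.
transitivity (\int[mu]_x normal_int r (fun y => (u (g x + y))%:E))%E.
  apply: eq_integral => x _; apply: (hr (fun y => (u (g x + y))%:E)) => // y.
  by rewrite lee_fin.
rewrite (gs (fun a => normal_int r (fun y => (u (a + y))%:E)))//.
  rewrite /normal_int; case: (r == 0).
    apply/measurable_EFinP; apply: (measurableT_comp mu').
    exact: measurable_funD.
  pose f (p : measurableTypeR R * measurableTypeR R) := (u (p.1 + p.2))%:E.
  apply: (measurable_fun_fubini_tonelli_F (m2 := normal_prob 0 r) f) => //.
    apply/measurable_EFinP; apply: (measurableT_comp mu').
    exact: measurable_funD.
  by move=> p; rewrite lee_fin.
move=> a; rewrite /normal_int; case: ifP => _; first by rewrite lee_fin.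
by apply: integral_ge0 => y _; rewrite lee_fin.
Qed.

(** Integrating the pointwise identity gives equal sums of variances, up to the second moment of the
    standard normal law, which cancels. *)
Lemma gaussian_parallelogram (g h g' h' : E -> R) s r s' r' :
  continuous g -> continuous h -> continuous g' -> continuous h' ->
  (forall x, g' x ^+ 2 + h' x ^+ 2 = g x ^+ 2 + h x ^+ 2) ->
  normal_under g s -> normal_under h r ->
  normal_under g' s' -> normal_under h' r' ->
  s' ^+ 2 + r' ^+ 2 = s ^+ 2 + r ^+ 2.
Proof.
move=> cg ch cg' ch' ghE gs hr g's' h'r'.
have mX2 : measurable_fun setT (fun x : R => (x ^+ 2)%:E).
  by apply/measurable_EFinP; exact: measurable_funX.
have X20 (x : R) : (0 <= (x ^+ 2)%:E)%E by rewrite lee_fin sqr_ge0.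
have [C0 Cy] := (normal_int_sqr_gt0 (R := R), normal_int_sqr_lty (R := R)).
have sumE (f k : E -> R) a b : continuous f -> continuous k ->
    normal_under f a -> normal_under k b ->
    (\int[mu]_x (f x ^+ 2 + k x ^+ 2)%:E =
     (a ^+ 2 + b ^+ 2)%:E * normal_int 1 (fun x => (x ^+ 2)%:E))%E.
  move=> cf ck [a0 fa] [b0 kb].
  have mf := continuous_borel_measurable cf.
  have mk := continuous_borel_measurable ck.
  under eq_integral do rewrite EFinD.
  rewrite ge0_integralD//; last 2 first.
  - by apply/measurable_EFinP; apply: measurable_funX.
  - by apply/measurable_EFinP; apply: measurable_funX.
  rewrite (fa (fun x => (x ^+ 2)%:E))// (kb (fun x => (x ^+ 2)%:E))//.
  by rewrite (normal_int_sqr a0) (normal_int_sqr b0) -ge0_muleDl ?lee_fin ?sqr_ge0// -EFinD.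
have := sumE _ _ _ _ cg ch gs hr.
under eq_integral do rewrite -ghE.
rewrite (sumE _ _ _ _ cg' ch' g's' h'r').
move: C0 Cy; case: (normal_int _ _) => // c c0 _.
rewrite -!EFinM => -[] /mulIf; apply.
by rewrite gt_eqF.
Qed.

(** Adding 1 gives a nonnegative integrand, as [integral_rotation] requires; the shifts 0 and
    [pi / 2] yield cosine and sine. *)
Lemma integral_cos_shift d (T : measurableType d) (P : probability T R)
    (f : T -> R) a : measurable_fun setT f ->
  (\int[P]_x (1 + cos (f x - a))%:E = 1 + \int[P]_x (cos (f x - a))%:E)%E.
Proof.
move=> mf.
have mc : measurable_fun setT (fun x => cos (f x - a)).
  apply: measurableT_comp; first exact: continuous_measurable_fun (@continuous_cos R).
  exact: measurable_funB.
under eq_integral do rewrite EFinD.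
rewrite integralD//; last 2 first.
- exact: (finite_measure_integrable_cst _ 1).
- apply: (@integrable_bounded _ _ _ _ _ 1) => // x.
  by rewrite ler_norml cos_geN1 cos_le1.
rewrite integral_cst// mul1e; congr (_ + _)%E; exact: probability_setT.
Qed.

Definition rotation (p : borel E * borel E) : borel E * borel E :=
  ((Num.sqrt 2)^-1 *: (p.1 + p.2 : E), (Num.sqrt 2)^-1 *: (p.1 - p.2 : E)).

(** The continuous functionals of the product, kept split into coordinates so that Tonelli
    applies. *)
Let dual_sums : set (borel E * borel E -> R) :=
  [set f | exists g h : {linear E -> R^o},
     [/\ continuous g, continuous h & f = fun p => g p.1 + h p.2]].

Let gen (Phi : set (borel E * borel E -> R)) :=
  [set [set x | fc.1 x < fc.2] | fc in [set fc : (borel E * borel E -> R) * R | Phi fc.1]].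

(** Rectangles suffice, and each side is handled by [open_dual_sigma_algebra], with the zero
    functional on the other coordinate. *)
Lemma prod_sigma_dual_sums : measurable `<=` <<s gen dual_sums >>.
Proof.
pose S := <<s gen dual_sums >>.
have [S0 SC SU] : sigma_algebra setT S by exact: smallest_sigma_algebra.
have Spre (k : borel E * borel E -> E) :
    (forall f : {linear E -> R^o}, continuous f -> dual_sums (f \o k)) ->
    forall A : set (borel E), measurable A -> S (k @^-1` A).
  move=> kP; have Ssig : sigma_algebra setT [set A | S (k @^-1` A)].
    split=> [|A|A] /=; first by rewrite preimage_set0.
    - by move=> /SC; rewrite !setTD.
    - by move=> /SU; rewrite preimage_bigcup.
  apply: smallest_sub => //; apply: open_dual_sigma_algebra => // f c cf.
  by apply: sub_sigma_algebra; exists (f \o k, c) => //=; exact: kP.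
rewrite measurable_prod_measurableType; apply: smallest_sub.
  exact: smallest_sigma_algebra.
have SI A B : S A -> S B -> S (A `&` B).
  move=> SA SB; rewrite -[A `&` B]setCK setCI -bigcup2E -setTD; apply: (SC).
  by apply: (SU) => -[|[|n]]; rewrite /bigcup2/= -?setTD; [exact: SC|exact: SC|].
move=> _ [A mA [B mB <-]]; rewrite -[_ `*` _]/((fst @^-1` A) `&` (snd @^-1` B)).
apply: SI.
  apply: (Spre fst) => // f cf; exists f, (\0 : {linear E -> R^o}); split => //.
    by move=> x; exact: cvg_cst.
  by apply/funext => p; rewrite /= addr0.
apply: (Spre snd) => // f cf; exists (\0 : {linear E -> R^o}), f; split => //.
  by move=> x; exact: cvg_cst.
by apply/funext => p; rewrite /= add0r.
Qed.

Lemma continuous_half_sum (c b : R) (g h : {linear E -> R^o}) :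
  continuous g -> continuous h -> continuous (fun x => c * (g x + b * h x)).
Proof.
move=> cg ch x; apply: cvgM; first exact: cvg_cst.
apply: cvgD; first exact: cg.
by apply: cvgM; [exact: cvg_cst|exact: ch].
Qed.

(** The rotation is transposed onto the pair of functionals; the factors [1] and [-1] match
    [continuous_half_sum]. *)
Lemma rotation_dual_sum (g h : {linear E -> R^o}) p :
  let c : R := (Num.sqrt 2)^-1 in
  g (rotation p).1 + h (rotation p).2 =
  c * (g p.1 + 1 * h p.1) + c * (g p.2 + -1 * h p.2).
Proof.
move=> c.
have gE : g (rotation p).1 = c * (g p.1 + g p.2).
  by rewrite -[RHS]/(c *: (g p.1 + g p.2)) -raddfD -linearZ.
have hE : h (rotation p).2 = c * (h p.1 - h p.2).
  by rewrite -[RHS]/(c *: (h p.1 - h p.2)) -raddfB -linearZ.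
by rewrite gE hE; ring.
Qed.

Lemma measurable_sum_prod (g h : E -> R) : continuous g -> continuous h ->
  measurable_fun setT (fun p : borel E * borel E => g p.1 + h p.2).
Proof.
move=> /continuous_borel_measurable mg /continuous_borel_measurable mh.
by apply: measurable_funD; apply: measurableT_comp.
Qed.

(** Measurability for the product sigma-algebra is checked on its generating half-spaces, whose
    preimages are again half-spaces. *)
Lemma measurable_rotation : measurable_fun setT rotation.
Proof.
move=> _ A mA; rewrite setTI.
have sub : gen dual_sums `<=` [set A | measurable (rotation @^-1` A)].
  move=> _ [[_ c] /= [g [h [cg ch ->]]] <-] /=.
  have mr := measurable_sum_prod (@continuous_half_sum (Num.sqrt 2)^-1 1 _ _ cg ch)
    (@continuous_half_sum (Num.sqrt 2)^-1 (-1) _ _ cg ch).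
  have := mr measurableT [set x | x < c] (open_measurable (open_lt (y := c))).
  rewrite setTI; congr measurable; apply/funext => p /=.
  by rewrite rotation_dual_sum.
apply: (smallest_sub _ sub (prod_sigma_dual_sums mA)).
split=> [|B|B] /=; first by rewrite preimage_set0.
- by move=> mB; rewrite setTD -preimage_setC; exact: measurableC.
- by move=> mB; rewrite preimage_bigcup; exact: bigcupT_measurable.
Qed.

(** Both sides are normal integrals, and the pointwise identity between the squares of [g'], [h']
    and those of [g], [h] makes their variances equal. *)
Lemma integral_rotation (g h : {linear E -> R^o}) (u : R -> R) :
  continuous g -> continuous h -> continuous u -> (forall x, 0 <= u x) ->
  (\int[mu \x mu]_p (u (g (rotation p).1 + h (rotation p).2))%:E =
   \int[mu \x mu]_p (u (g p.1 + h p.2))%:E)%E.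
Proof.
move=> cg ch cu u0; pose c : R := (Num.sqrt 2)^-1.
have [s gs] := gaussian_normal_under cg.
have [r hr] := gaussian_normal_under ch.
pose g' : {linear E -> R^o} := c \*: (g \+ h).
pose h' : {linear E -> R^o} := c \*: (g \- h).
have g'E x : g' x = c * (g x + 1 * h x) by rewrite mul1r.
have h'E x : h' x = c * (g x + -1 * h x) by rewrite mulN1r.
have cg' : continuous g'.
  move=> x; apply: cvgZl_tmp; apply: cvgD; [exact: cg|exact: ch].
have ch' : continuous h'.
  move=> x; apply: cvgZl_tmp; apply: cvgB; [exact: cg|exact: ch].
have [s' g's'] := gaussian_normal_under cg'.
have [r' h'r'] := gaussian_normal_under ch'.
have srE : s' ^+ 2 + r' ^+ 2 = s ^+ 2 + r ^+ 2.
  apply: (gaussian_parallelogram cg ch cg' ch' _ gs hr g's' h'r') => x.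
  have c2 : c ^+ 2 = 2^-1 by rewrite exprVn sqr_sqrtr.
  by rewrite g'E h'E !exprMn c2; field.
transitivity (normal_int (Num.sqrt (s ^+ 2 + r ^+ 2)) (EFin \o u)); last first.
  exact/esym/(integral_normal_sum cg ch gs hr cu u0).
rewrite -srE; have <- := integral_normal_sum cg' ch' g's' h'r' cu u0.
by apply: eq_integral => p _; rewrite rotation_dual_sum -/c -g'E -h'E.
Qed.

(** By [cramer_wold] it suffices to compare the trigonometric integrals of dual sums under the
    product law [P] and its image [Q]. *)
Theorem gaussian_rotation_invariant (A : set (borel E * borel E)) : measurable A ->
  ((mu \x mu) (rotation @^-1` A) = (mu \x mu) A)%E.
Proof.
move=> mA; pose P : probability (borel E * borel E)%type R := (mu \x mu)%E.
pose X : {mfun (borel E * borel E)%type >-> (borel E * borel E)%type} :=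
  mfun_Sub (mem_set measurable_rotation).
pose Q : probability (borel E * borel E)%type R := distribution P X.
have mPhi f : dual_sums f -> measurable_fun setT f.
  by move=> [g [h [cg ch ->]]]; exact: measurable_sum_prod.
have cosPQ f a : dual_sums f ->
    (\int[P]_x (cos (f x - a))%:E = \int[Q]_x (cos (f x - a))%:E)%E.
  move=> Pf.
  suff : (1 + \int[P]_x (cos (f x - a))%:E = 1 + \int[Q]_x (cos (f x - a))%:E)%E.
    by move/(congr1 (fun z => z - 1)%E); rewrite [(1 + _)%E]addeC [(1 + _)%E in RHS]addeC !addeK.
  rewrite -!integral_cos_shift; [|exact: mPhi..].
  have u0 (y : R) : 0 <= 1 + cos (y - a) by have := cos_geN1 (y - a); lra.
  have cu : continuous (fun y : R => 1 + cos (y - a)).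
    move=> y; apply: cvgD; first exact: cvg_cst.
    apply: (@cvg_comp _ _ _ (fun y => y - a) cos); last exact: continuous_cos.
    by apply: cvgB; [exact: cvg_id|exact: cvg_cst].
  have mf := mPhi _ Pf.
  have mU : measurable_fun setT (fun x => (1 + cos (f x - a))%:E).
    apply/measurable_EFinP.
    exact: (measurableT_comp (continuous_measurable_fun cu) mf).
  have U0 x : (0 <= (1 + cos (f x - a))%:E)%E by rewrite lee_fin.
  rewrite (ge0_integral_distribution X mU U0).
  case: Pf => g [h [cg ch fE]]; rewrite fE.
  by rewrite -(integral_rotation cg ch cu u0).
apply/esym; apply: (@cramer_wold _ _ _ P Q dual_sums) => //.
- move=> a b _ _ [g [h [cg ch ->]]] [g' [h' [cg' ch' ->]]].
  exists ((a \*: g) \+ (b \*: g')), ((a \*: h) \+ (b \*: h')); split.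
  + by move=> x; apply: cvgD; apply: cvgZl_tmp; [exact: cg|exact: cg'].
  + by move=> x; apply: cvgD; apply: cvgZl_tmp; [exact: ch|exact: ch'].
  + by apply/funext => p; rewrite /= /GRing.scale/=; ring.
- exists (fun=> 0), (\0 : {linear E -> R^o}), (\0 : {linear E -> R^o}); split.
  + by move=> x; exact: cvg_cst.
  + by move=> x; exact: cvg_cst.
  + by apply/funext => p; rewrite /= addr0.
- move=> f Pf; have := cosPQ f 0 Pf.
  by under eq_integral do rewrite subr0; under [in RHS]eq_integral do rewrite subr0.
- move=> f Pf; have := cosPQ f (pi / 2) Pf.
  by under eq_integral do rewrite cosBpihalf; under [in RHS]eq_integral do rewrite cosBpihalf.
- exact: prod_sigma_dual_sums.
Qed.

End gaussian_rotation.

(** * Fernique's estimate *)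

Section fernique.
Context {R : realType} {E : completeNormedModType R}.
Hypothesis Esep : separable E.
Variable mu : probability (borel E) R.
Hypothesis mu_gauss : centered_gaussian mu.

(** For nonzero [t] this is [t K]; as a preimage it is measurable by continuity. *)
Definition dilation (t : R) (K : set E) : set E := [set x | K (t^-1 *: x)].

Lemma borel_preimage (f : E -> E) (A : set E) : continuous f ->
  measurable (A : set (borel E)) -> measurable (f @^-1` A : set (borel E)).
Proof.
move=> cf; move: A; apply: smallest_sub.
  split=> [|A|A] /=; first by rewrite preimage_set0.
  - by move=> mA; rewrite setTD -preimage_setC; exact: measurableC.
  - by move=> mA; rewrite preimage_bigcup; exact: bigcupT_measurable.
by move=> U oU; apply: borel_open; move/continuousP : cf; exact.
Qed.

Lemma measurable_dilation t (K : set E) :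
  measurable (K : set (borel E)) -> measurable (dilation t K : set (borel E)).
Proof.
by apply: borel_preimage => x; apply: cvgZl_tmp; exact: cvg_id.
Qed.

Lemma dilation_subset u t (K : set E) : absconvex K -> 0 < u -> u <= t ->
  dilation u K `<=` dilation t K.
Proof.
move=> aK u0 ut x Kx; rewrite /dilation/=.
have t0 : 0 < t by exact: lt_le_trans ut.
have -> : t^-1 *: x = (u / t) *: (u^-1 *: x) + 0 *: (u^-1 *: x).
  by rewrite scale0r addr0 scalerA mulrAC mulfV ?mul1r// gt_eqF.
apply: aK => //; rewrite normr0 addr0 ger0_norm ?divr_ge0 ?(ltW u0) ?(ltW t0)//.
by rewrite ler_pdivrMr// mul1r.
Qed.

(** Since [(x - y) / sqrt 2 = sqrt 2 x - (x + y) / sqrt 2], having [x] in [u K] and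
    [(x + y) / sqrt 2] in [K] would put the left side in [(1 + sqrt 2 u) K]; likewise for [y]. *)
Lemma rotation_dilation u (K : set E) : absconvex K -> 0 < u ->
  rotation @^-1` (K `*` ~` dilation (1 + Num.sqrt 2 * u) K) `<=`
  ~` dilation u K `*` ~` dilation u K.
Proof.
move=> aK u0 [x y] [/= Kxy nK].
set c : R := (Num.sqrt 2)^-1 in Kxy nK *; set t := 1 + _ in nK *.
have c0 : 0 < c by rewrite invr_gt0 sqrtr_gt0.
have s2 : Num.sqrt 2 = 2 * c :> R.
  by rewrite /c -{2}(@sqr_sqrtr R 2)// expr2 mulfK// gt_eqF// sqrtr_gt0.
have t0 : 0 < t by rewrite /t addr_gt0// mulr_gt0// sqrtr_gt0.
(* The weights of the absolutely convex combination are [b = sqrt 2 u / t] and [1 / t], of sum 1. *)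
pose b := t^-1 * (2 * c * u).
have b0 : 0 <= b by rewrite !mulr_ge0// ?invr_ge0 ?(ltW t0) ?(ltW c0) ?(ltW u0).
have bt : b + t^-1 = 1.
  have -> : b + t^-1 = t^-1 * t by rewrite /b /t s2; ring.
  by rewrite mulVf// gt_eqF.
have bu z : b *: (u^-1 *: z) = (t^-1 * c * 2) *: z.
  rewrite scalerA; congr (_ *: _).
  by rewrite /b; field; rewrite !gt_eqF.
have ti0 : 0 <= t^-1 by rewrite invr_ge0 ltW.
have xyE : (t^-1 * c) *: (x - y) = b *: (u^-1 *: x) + (- t^-1) *: (c *: (x + y)).
  rewrite bu scalerA [_ * 2]mulr_natr mulr2n scalerDl mulNr scaleNr.
  by rewrite !scalerDr scalerN opprD addrACA subrr add0r.
split=> Kx; apply: nK; rewrite /dilation/= scalerA.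
  rewrite xyE; apply: aK => //; rewrite normrN !ger0_norm// bt//.
have -> : (t^-1 * c) *: (x - y) = (- b) *: (u^-1 *: y) + t^-1 *: (c *: (x + y)).
  rewrite scaleNr bu scalerA [_ * 2]mulr_natr mulr2n scalerDl !scalerDr.
  by rewrite scalerN opprD addrACA addNr addr0 addrC.
by apply: aK => //; rewrite normrN !ger0_norm// bt.
Qed.

(** Rotation invariance of the product measure turns the inclusion [rotation_dilation] into an
    inequality between products. *)
Lemma fernique_step u (K : set E) : measurable (K : set (borel E)) ->
  absconvex K -> 0 < u ->
  (mu K * mu (~` dilation (1 + Num.sqrt 2 * u) K) <=
   mu (~` dilation u K) * mu (~` dilation u K))%E.
Proof.
move=> mK aK u0.
have md t := measurableC (measurable_dilation t mK).
rewrite -[leLHS](product_measure1E mu mu mK (md _)).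
rewrite -[leRHS](product_measure1E mu mu (md _) (md _)).
rewrite -(gaussian_rotation_invariant Esep mu_gauss); last exact: measurableX.
apply: le_measure; rewrite ?inE; last exact: rotation_dilation.
  have := measurable_rotation Esep measurableT (measurableX mK (md (1 + Num.sqrt 2 * u))).
  by rewrite setTI.
exact: measurableX.
Qed.

Fixpoint fernique_radius n : R :=
  if n is n'.+1 then 1 + Num.sqrt 2 * fernique_radius n' else 1.

Lemma fernique_radius_gt0 n : 0 < fernique_radius n.
Proof. by case: n => [|n] //=; elim: n => [|n IH]/=; rewrite addr_gt0// mulr_gt0// sqrtr_gt0. Qed.

(** The term [- 3] makes the induction close, as [1 - 3 sqrt 2 <= - 3] amounts to
    [4 / 3 <= sqrt 2]. *)
Lemma fernique_radius_le n : fernique_radius n <= 4 * Num.sqrt 2 ^+ n - 3.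
Proof.
have s43 : 4 / 3 <= Num.sqrt 2 :> R.
  rewrite -[leLHS]ger0_norm ?divr_ge0// -sqrtr_sqr ler_sqrt//; lra.
elim: n => [|n IH] /=; first by rewrite expr0; lra.
rewrite exprS.
have := ler_wpM2l (sqrtr_ge0 2) IH; lra.
Qed.

(** Each step squares the bound on [a n / m], which starts at most at
    [(1 / 5) / (4 / 5) = 1 / 4 <= exp (- 1)]. *)
Lemma fernique_seq (K : set E) n : measurable (K : set (borel E)) ->
  absconvex K -> (mu (~` K) <= (5^-1)%:E)%E ->
  (mu (~` dilation (fernique_radius n) K) <= (expR (- (2 ^+ n)))%:E)%E.
Proof.
move=> mK aK K5.
have md t := measurableC (measurable_dilation t mK).
have fin A (mA : measurable A) := fineK (fin_num_measure mu A mA).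
pose m := fine (mu K).
pose a n := fine (mu (~` dilation (fernique_radius n) K)).
have m1 : m <= 1 by rewrite -lee_fin fin// probability_le1.
have m45 : 4 / 5 <= m.
  move: K5; rewrite probability_setC// -[mu K]fin// -EFinB lee_fin -/m; lra.
have a_ge0 k : 0 <= a k by rewrite -lee_fin fin.
have step k : m * a k.+1 <= a k * a k.
  rewrite -lee_fin !EFinM !fin//; apply: fernique_step => //.
  exact: fernique_radius_gt0.
suff : a n <= m * expR (- 2 ^+ n).
  move=> an; rewrite -[leLHS]fin// lee_fin (le_trans an)//.
  by rewrite ler_piMl// expR_ge0.
elim: n => [|n IH].
  have a0 : a 0%N <= 5^-1.
    rewrite -lee_fin fin//=; apply: le_trans K5; rewrite le_eqVlt; apply/orP; left.
    apply/eqP; congr (mu (~` _)); apply/funext => x.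
    by rewrite /dilation/= invr1 scale1r.
  have e14 : 4^-1 <= expR (-1) :> R.
    have -> : expR (-1) = expR (- 2^-1) * expR (- 2^-1) :> R.
      by rewrite -expRD; congr expR; lra.
    have h := expR_ge1Dx (- 2^-1 : R).
    have -> : 4^-1 = 2^-1 * 2^-1 :> R by lra.
    by apply: ler_pM => //; lra.
  rewrite expr0 (le_trans a0)//.
  by have := ler_pM (ltac:(lra) : 0 <= 4/5 :> R) (ltac:(lra) : 0 <= 4^-1 :> R) m45 e14; lra.
have m0 : 0 < m by lra.
rewrite -(ler_pM2l m0) (le_trans (step n))//.
have -> : m * (m * expR (- 2 ^+ n.+1)) = (m * expR (- 2 ^+ n)) * (m * expR (- 2 ^+ n)).
  rewrite mulrACA -expRD -mulrA; congr (_ * (_ * expR _)).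
  by rewrite exprS; ring.
by apply: ler_pM.
Qed.

(** With [n] maximal such that [2 ^ n <= t ^ 2 / 16], the radius is at most [4 * sqrt 2 ^ n <= t],
    while [2 ^ n >= t ^ 2 / 32]. *)
Lemma fernique (K : set E) t : measurable (K : set (borel E)) ->
  absconvex K -> (mu (~` K) <= (5^-1)%:E)%E -> 4 <= t ->
  (mu (~` dilation t K) <= (expR (- (t ^+ 2 / 32)))%:E)%E.
Proof.
move=> mK aK K5 t4.
have t16 : 1 <= t ^+ 2 / 16.
  by rewrite ler_pdivlMr// mul1r (_ : 16 = 4 ^+ 2) ?ler_sqr ?nnegrE//; lra.
pose N := Num.trunc (t ^+ 2 / 16).
have N0 : (0 < N)%N by rewrite /N truncn_gt0.
have /andP[NL NU] : N%:R <= t ^+ 2 / 16 < N.+1%:R.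
  by apply: truncn_itv; lra.
pose n := trunc_log 2 N.
have /andP[nL nU] : (2 ^ n <= N < 2 ^ n.+1)%N by exact: trunc_log_bounds.
have nL' : 2 ^+ n <= t ^+ 2 / 16 by rewrite (le_trans _ NL)// -natrX ler_nat.
(* As [N] is an integer, [N < 2 ^ n.+1] gives [N + 1 <= 2 ^ n.+1]. *)
have nU' : t ^+ 2 / 16 <= 2 ^+ n.+1.
  by rewrite (le_trans (ltW NU))// -natrX ler_nat.
have rt : fernique_radius n <= t.
  rewrite (le_trans (fernique_radius_le n))// (@le_trans _ _ (4 * Num.sqrt 2 ^+ n))//.
    by rewrite lerBlDr lerDl.
  rewrite -ler_sqr ?nnegrE ?mulr_ge0 ?exprn_ge0 ?sqrtr_ge0//; last by lra.
  rewrite exprMn -exprM mulnC exprM sqr_sqrtr//.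
  lra.
apply: (@le_trans _ _ (mu (~` dilation (fernique_radius n) K))).
  have md k := measurableC (measurable_dilation k mK).
  apply: le_measure; rewrite ?inE; [exact: md..|].
  exact/subsetC/(dilation_subset aK (fernique_radius_gt0 n) rt).
rewrite (le_trans (fernique_seq n mK aK K5))// lee_fin ler_expR lerN2.
move: nU'; rewrite [2 ^+ n.+1]exprS; lra.
Qed.

End fernique.

(** * Exponential tightness *)

Unset Implicit Arguments.

Theorem mainTheorem2 (R : realType) (E : completeNormedModType R)
    (Esep : separable E) (mu : probability (borel E) R)
    (mu_gauss : centered_gaussian mu) :
  exponentially_tight (scaled mu) (fun e : R => e ^+ 2).
Proof.
move=> r r0.
have r5 : (0 : R) < 5^-1 by rewrite invr_gt0.
have [K [mK aK tK K5]] := tight_absconvex mu Esep r5.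
(* Chosen so that Fernique's exponent [(l / e) ^ 2 / 32] equals [r / e ^ 2]. *)
pose l : R := Num.sqrt (32 * r).
have l2 : l ^+ 2 = 32 * r by rewrite sqr_sqrtr// mulr_ge0// ltW.
have l0 : 0 < l by rewrite sqrtr_gt0 mulr_gt0.
have cK : compact (closure K).
  apply: totally_bounded_compact; first exact: closed_closure.
  exact: totally_bounded_closure.
pose KR := [set l *: x | x in closure K].
have cKR : compact KR.
  apply: continuous_compact => //; apply: continuous_subspaceT => x.
  by apply: cvgZl_tmp; exact: cvg_id.
exists KR => //.
(* The restriction [e < l / 4] gives [4 <= l / e], the range of [fernique]. *)
have bound e : 0 < e -> e < l / 4 ->
    (scaled mu e (~` KR) <= (expR (- (r / e ^+ 2)))%:E)%E.
  move=> e0 el.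
  have le4 : 4 <= l / e by rewrite ler_pdivlMr// mulrC -ler_pdivlMr// ltW.
  have -> : r / e ^+ 2 = (l / e) ^+ 2 / 32.
    by rewrite exprMn l2 exprVn; field; rewrite gt_eqF.
  apply: le_trans (fernique Esep mu_gauss mK aK K5 le4).
  rewrite /scaled /pushforward; apply: le_measure; rewrite ?inE.
  - apply: borel_open.
    have /continuousP : continuous (fun x : E => e *: x).
      by move=> x; apply: cvgZl_tmp; exact: cvg_id.
    apply; apply: closed_openC; apply: compact_closed => //; exact: norm_hausdorff.
  - exact: (measurableC (measurable_dilation _ mK)).
  (* If [e *: x] lies outside [l * closure K], then [x] lies outside [(l / e) K]. *)
  - apply: subsetC => x Kx /=; exists ((l / e)^-1 *: x); first exact: subset_closure.
    by rewrite scalerA invf_div mulrCA mulfV ?mulr1// gt_eqF.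
(* The interval (0, l / 4) is a right neighbourhood of 0, so the limit superior is at most the
   supremum over it. *)
apply: (@le_trans _ _ (ereal_sup
    [set ((e ^+ 2)%:E * lne (scaled mu e (~` KR)))%E | e in [set e | 0 < e < l / 4]])).
  apply: ereal_inf_lbound; exists [set e | 0 < e < l / 4] => //.
  near=> e; apply/andP; split => //.
  near: e; apply: nbhs_right_lt; exact: divr_gt0.
apply: ge_ereal_sup => _ [e /= /andP[e0 el] <-].
have e2 : 0 < e ^+ 2 by rewrite exprn_gt0.
apply: (@le_trans _ _ ((e ^+ 2)%:E * (- (r / e ^+ 2))%:E)%E).
  rewrite lee_pmul2l ?lte_fin//.
  have nu0 : (0 <= scaled mu e (~` KR))%E by rewrite /scaled /pushforward; exact: measure_ge0.
  rewrite -[X in (_ <= X%:E)%E]expRK -lne_EFin ?expR_gt0//.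
  by rewrite lee_lne ?in_itv/= ?leey ?andbT ?lee_fin ?expR_ge0// bound.
by rewrite -EFinM lee_fin mulrN mulrC divfK// gt_eqF.
Unshelve. all: by end_near. Qed.
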